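(* Let $n\ge 3$ and let $C_n$ be the cycle graph on the vertex set $[n]$. For every $k\in[n]$, the maximum likelihood degree of the spanning tree concentration model $\mathcal{M}(C_n,k)$ is equal to the number of subsets of $[n-1]$ with at least two elements, i.e. to $2^{n-1}-n$ (called the $(n-1)$st Eulerian number).
   Context: For a simple graph $G=([n],E)$, attach to each edge $e\in E$ a variable $x_e$. The Laplacian $L(G)(\mathbf{x}_E)$ is the symmetric $n\times n$ matrix with off-diagonal entries $-x_{ij}$ if $ij\in E$ and $0$ if $i\neq j$, $ij\notin E$, and with diagonal entries $\sum_{j:\,ij\in E}x_{ij}$. For a vertex $k$, $L(G)_{\widehat k,\widehat k}$ is $L(G)$ with row and column $k$ deleted, and $\mathcal{M}(G,k)=\{L(G)_{\widehat k,\widehat k}(\mathbf{x}_E) : \mathbf{x}_E\in\mathbb{C}^{E}\}$. For a linear space $\mathcal{M}=\{K(\mathbf{x})=\sum_i x_iK_i\}$ of complex symmetric $m\times m$ matrices, with $K_i$ linearly independent, the maximum likelihood (ML) degree of $\mathcal{M}$ is the number of complex critical points $\mathbf{x}$, with $\det K(\mathbf{x})\neq 0$, of the log-likelihood function $\log\det K(\mathbf{x})-\operatorname{tr}(S K(\mathbf{x}))$, for generic complex symmetric $S$; that is, the number of solutions of $\partial_{x_i}\det K(\mathbf{x})/\det K(\mathbf{x})=\operatorname{tr}(SK_i)$ for all $i$. *)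

(* Defs.v *)
From HB Require Import structures.
From mathcomp Require Import all_boot all_order all_algebra.
From mathcomp Require Import mpoly.

Set Implicit Arguments.
Unset Strict Implicit.
Unset Printing Implicit Defensive.

Import GRing.Theory.
Local Open Scope ring_scope.

Record simple_graph (n : nat) := SimpleGraph {
  edges : {set {set 'I_n}};
  edges_card2 : forall e, e \in edges -> #|e| = 2%N }.

Definition edge n (G : simple_graph n) := {e : {set 'I_n} | e \in edges G}.

Section Laplacian.
Variables (F : fieldType) (n : nat) (G : simple_graph n).
Implicit Types x : {ffun edge G -> F^o}.

(* The value x_{ij}, extended by 0 to the pairs ij that are not edges. *)
Definition edge_val x (i j : 'I_n) : F :=
  oapp x 0 (insub [set i; j] : option (edge G)).

Definition laplacian x : 'M[F]_n :=
  \matrix_(i, j)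
    if i == j then \sum_(l | [set i; l] \in edges G) edge_val x i l
    else if [set i; j] \in edges G then - edge_val x i j else 0.

Definition reduced_laplacian (k : 'I_n) x : 'M[F]_n.-1 :=
  row' k (col' k (laplacian x)).

Fact edge_val_linear i j : scalar (fun x => edge_val x i j).
Proof.
move=> a x y; rewrite /edge_val; case: insub => [e|] /=; last by rewrite mulr0 addr0.
by rewrite !ffunE.
Qed.

Fact reduced_laplacian_linear k : linear (reduced_laplacian k).
Proof.
move=> a x y; apply/matrixP=> i j; rewrite !mxE.
case: ifP => _.
  rewrite mulr_sumr -big_split; apply: eq_bigr => l _; exact: edge_val_linear.
case: ifP => _; last by rewrite mulr0 addr0.
by rewrite edge_val_linear opprD mulrN.
Qed.

HB.instance Definition _ k := GRing.isLinear.Build F {ffun edge G -> F^o}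
  'M[F]_n.-1 _ (reduced_laplacian k) (reduced_laplacian_linear k).

Definition spanning_tree_model (k : 'I_n) : {vspace 'M[F]_n.-1} :=
  limg (linfun (reduced_laplacian k)).

Lemma mem_spanning_tree_model k A :
  A \in spanning_tree_model k <-> exists x, A = reduced_laplacian k x.
Proof.
split=> [/memv_imgP[x _ ->]|[x ->]]; first by exists x; rewrite lfunE.
by rewrite -[reduced_laplacian k x](lfunE (reduced_laplacian k)) memv_img ?memvf.
Qed.

Lemma spanning_tree_model_sym k A : A \in spanning_tree_model k -> A^T = A.
Proof.
move=> /mem_spanning_tree_model[x ->]; apply/matrixP=> i j; rewrite !mxE.
rewrite eq_sym; case: eqP => [->//|_]; by rewrite /edge_val setUC.
Qed.

End Laplacian.

(* [ordS i] is [i + 1] modulo [n]; the condition [ordS i != i] only discards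
   the degenerate loop of the case [n = 1]. *)
Definition cycle_edges n : {set {set 'I_n}} :=
  [set [set i; ordS i] | i in [pred i : 'I_n | ordS i != i]].

Fact cycle_edges_card2 n e : e \in cycle_edges n -> #|e| = 2%N.
Proof. by case/imsetP=> i; rewrite inE eq_sym => ne_i ->; rewrite cards2 ne_i. Qed.

Definition cycle_graph n : simple_graph n := SimpleGraph (@cycle_edges_card2 n).

Section MLDegree.
Variables (F : fieldType) (m : nat).

(* det (sum_i x_i K_i), as a polynomial in the variables x_i. *)
Definition det_poly r (K : r.-tuple 'M[F]_m) : {mpoly F[r]} :=
  \det (\sum_(i < r) 'X_i *: map_mx (@mpolyC r F) (tnth K i)).

Definition critical_point r (K : r.-tuple 'M[F]_m) (S : 'M[F]_m)
    (x : {ffun 'I_r -> F}) : Prop :=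
  (det_poly K).@[x] != 0 /\
  forall i, (det_poly K)^`M(i).@[x] / (det_poly K).@[x] = \tr (S *m tnth K i).

Definition has_card (T : eqType) (Q : T -> Prop) (d : nat) : Prop :=
  exists s : seq T, [/\ uniq s, size s = d & forall x, x \in s <-> Q x].

(* [Q] holds on a nonempty Zariski-open subset of the space of symmetric
   matrices. *)
Definition for_generic_sym (Q : 'M[F]_m -> Prop) : Prop :=
  exists P : {mpoly F[m * m]},
    (exists S : 'M[F]_m, S^T = S /\ P.@[mxvec S 0] != 0) /\
    (forall S : 'M[F]_m, S^T = S -> P.@[mxvec S 0] != 0 -> Q S).

Definition has_ml_degree (M : {vspace 'M[F]_m}) (d : nat) : Prop :=
  forall r (K : r.-tuple 'M[F]_m), basis_of M K ->
    for_generic_sym (fun S => has_card (critical_point K S) d).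

End MLDegree.

Lemma for_generic_sym_meet (F : numFieldType) m (Q1 Q2 : 'M[F]_m -> Prop) :
  for_generic_sym Q1 -> for_generic_sym Q2 -> exists S, Q1 S /\ Q2 S.
Proof.
move=> [P1 [[S1 [sym1 nz1]] H1]] [P2 [[S2 [sym2 nz2]] H2]].
pose h i : {poly F} := (mxvec S1 0 i)%:P + (mxvec (S2 - S1) 0 i) *: 'X.
pose L (t : F) := S1 + t *: (S2 - S1).
have hE P t : (mmap polyC h P).[t] = P.@[mxvec (L t) 0].
  rewrite mevalE /mmap horner_sum; apply: eq_bigr => c _.
  rewrite hornerCM /mmap1 horner_prod; congr (_ * _); apply: eq_bigr => i _.
  by rewrite horner_exp /h !hornerE /L /mxvec !castmxE !mxE mulrC.
have L0 : L 0 = S1 by rewrite /L scale0r addr0.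
have L1 : L 1 = S2 by rewrite /L scale1r addrC subrK.
pose q := mmap polyC h P1 * mmap polyC h P2.
have q_neq0 : q != 0.
  apply/negP; rewrite mulf_eq0 => /orP[/eqP q0|/eqP q0].
    by move: nz1; rewrite -L0 -hE q0 horner0 eqxx.
  by move: nz2; rewrite -L1 -hE q0 horner0 eqxx.
have /allPn[t _ /negbTE tq] : ~~ all (root q) [seq i%:R | i <- iota 0 (size q)].
  apply/negP=> /(max_poly_roots q_neq0) H.
  suff /H : uniq [seq i%:R : F | i <- iota 0 (size q)] by rewrite size_map size_iota ltnn.
  by rewrite map_inj_uniq ?iota_uniq //; exact: Num.Theory.mulrIn (oner_neq0 F).
have symL : (L t)^T = L t by rewrite /L linearD /= linearZ /= linearB /= sym1 sym2.
move: tq; rewrite /q rootM /root !hE => /negbT; rewrite negb_or => /andP[? ?].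
by exists (L t); split; [apply: H1|apply: H2].
Qed.

Lemma has_ml_degree_unique (F : numFieldType) m (M : {vspace 'M[F]_m}) d1 d2 :
  has_ml_degree M d1 -> has_ml_degree M d2 -> d1 = d2.
Proof.
move=> /(_ _ _ (vbasisP M)) H1 /(_ _ _ (vbasisP M)) H2.
have [S [[s1 [u1 <- e1]] [s2 [u2 <- e2]]]] := for_generic_sym_meet H1 H2.
apply/perm_size/uniq_perm => // x.
by apply/idP/idP => [/e1/e2|/e2/e1].
Qed.

(* Main.v *)
From HB Require Import structures.
Require Import Defs.
From mathcomp Require Import all_boot all_order all_algebra.
From mathcomp Require Import perm ring zify mpoly.
From mathcomp Require Import complex reals.

Set Implicit Arguments.
Unset Strict Implicit.
Unset Printing Implicit Defensive.

Import Order.TTheory GRing.Theory Num.Theory.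
Local Open Scope ring_scope.

(** Put m = n - 1. After a constant congruence the reduced Laplacian of the
cycle is diag(Y_1, ..., Y_m) + Y_0 J with J the all-ones matrix, so its
determinant is, up to a constant, E(Y) = sum_i prod_(j != i) Y_j and the
critical equations are dE/dY_i = s_i E with s_i = tr(S K_i). For generic s no
Y_i vanishes, and with q_i = 1 / Y_i, Q = sum_i q_i, V_i = 2 q_i / Q - 1 they
become

  sum_i V_i = 1 - m,   s_0 (V_i^2 - 1) = s_i (V_0^2 - 1),   V_0^2 <> 1.

Dropping the last condition adds exactly m + 1 solutions (all V_i = -1 except
one, which is 1), so it suffices to find 2^m solutions V. Solve for
V_1, ..., V_m by square roots in terms of z = V_0; the product of the linear
equation over all choices of signs is a polynomial N(z) of degree at most 2^m.
If deg N = 2^m and N is coprime to the product of the radicands and of the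
norm of the Jacobian, then at each root of N every vanishing factor has a
simple zero, so the multiplicity of the root is the number of solutions above
it, and there are 2^m in total. The conditions on s are the nonvanishing of a
resultant, which holds at s = (1, 0, ..., 0), where all radicands are 1. *)

(** * Norms from a tower of square roots *)

(* [sqext R k] encodes R[v_0, ..., v_(k-1)] / (v_i ^+ 2 = w_i): a pair [(x, y)]
   stands for x + v_0 * y, with the remaining indices shifted by one. The
   radicands w enter only in [sqext_mul] and [sqext_norm]. *)
Fixpoint sqext (R : Type) (k : nat) : Type :=
  if k is k'.+1 then (sqext R k' * sqext R k')%type else R.

Section SquareRootTower.
Variable R : comNzRingType.

Fixpoint sqext_const k (c : R) : sqext R k :=
  if k is k'.+1 then (sqext_const k' c, sqext_const k' 0) else c.

Fixpoint sqext_add k : sqext R k -> sqext R k -> sqext R k :=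
  if k is k'.+1 then fun x y => (sqext_add x.1 y.1, sqext_add x.2 y.2)
  else fun x y => x + y.

Fixpoint sqext_scale k (c : R) : sqext R k -> sqext R k :=
  if k is k'.+1 then fun x => (sqext_scale c x.1, sqext_scale c x.2)
  else fun x => c * x.

Fixpoint sqext_mul k : ('I_k -> R) -> sqext R k -> sqext R k -> sqext R k :=
  if k is k'.+1 then fun w x y =>
    let w' i := w (lift ord0 i) in
    (sqext_add (sqext_mul w' x.1 y.1)
               (sqext_scale (w ord0) (sqext_mul w' x.2 y.2)),
     sqext_add (sqext_mul w' x.1 y.2) (sqext_mul w' x.2 y.1))
  else fun _ x y => x * y.

(** Multiplying by the conjugate under [v_0 -> - v_0] gives [x.1 ^+ 2 - w_0 * x.2 ^+ 2], free of
    [v_0]; the other roots are eliminated recursively. *)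
Fixpoint sqext_norm k : ('I_k -> R) -> sqext R k -> R :=
  if k is k'.+1 then fun w x =>
    let w' i := w (lift ord0 i) in
    sqext_norm w' (sqext_add (sqext_mul w' x.1 x.1)
                     (sqext_scale (- w ord0) (sqext_mul w' x.2 x.2)))
  else fun _ x => x.

Fixpoint sqext_eval k : ('I_k -> R) -> sqext R k -> R :=
  if k is k'.+1 then fun v x =>
    let v' i := v (lift ord0 i) in
    sqext_eval v' x.1 + v ord0 * sqext_eval v' x.2
  else fun _ x => x.

(* c + v_0 + ... + v_(k-1) *)
Fixpoint sqext_lin k (c : R) : sqext R k :=
  if k is k'.+1 then (sqext_lin k' c, sqext_const k' 1) else c.

(* v_0 * ... * v_(k-1) *)
Fixpoint sqext_prod k : sqext R k :=
  if k is k'.+1 then (sqext_const k' 0, sqext_prod k') else 1.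

(* (v_0 * ... * v_(k-1)) * (1 + a_0 / v_0 + ... + a_(k-1) / v_(k-1)) *)
Fixpoint sqext_jac k : ('I_k -> R) -> sqext R k :=
  if k is k'.+1 then fun a =>
    (sqext_scale (a ord0) (sqext_prod k'), sqext_jac (fun i => a (lift ord0 i)))
  else fun=> 1.

Lemma eq_sqext_eval k (v v' : 'I_k -> R) : v =1 v' -> sqext_eval v =1 sqext_eval v'.
Proof.
elim: k v v' => [//|k IHk] v v' eqv [x y] /=.
by rewrite eqv; congr (_ + _ * _); apply: IHk => i; apply: eqv.
Qed.

Lemma sqext_eval_const k v c : sqext_eval v (sqext_const k c) = c.
Proof. by elim: k v c => [//|k IHk] v c /=; rewrite !IHk mulr0 addr0. Qed.

Lemma sqext_eval_add k v (x y : sqext R k) :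
  sqext_eval v (sqext_add x y) = sqext_eval v x + sqext_eval v y.
Proof.
elim: k v x y => [//|k IHk] v [x1 x2] [y1 y2] /=; rewrite !IHk; ring.
Qed.

Lemma sqext_eval_scale k v c (x : sqext R k) :
  sqext_eval v (sqext_scale c x) = c * sqext_eval v x.
Proof. elim: k v x => [//|k IHk] v [x1 x2] /=; rewrite !IHk; ring. Qed.

Lemma sqext_eval_mul k v w (x y : sqext R k) : (forall i, v i ^+ 2 = w i) ->
  sqext_eval v (sqext_mul w x y) = sqext_eval v x * sqext_eval v y.
Proof.
elim: k v w x y => [//|k IHk] v w [x1 x2] [y1 y2] vw /=.
rewrite !sqext_eval_add sqext_eval_scale !(IHk (fun i => v (lift ord0 i))) //.
rewrite -(vw ord0); ring.
Qed.

Lemma sqext_eval_lin k v c : sqext_eval v (sqext_lin k c) = c + \sum_i v i.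
Proof.
elim: k v c => [|k IHk] v c /=; first by rewrite big_ord0 addr0.
by rewrite big_ord_recl IHk sqext_eval_const; ring.
Qed.

Lemma sqext_eval_prod k v : sqext_eval v (sqext_prod k) = \prod_i v i.
Proof.
elim: k v => [|k IHk] v /=; first by rewrite big_ord0.
by rewrite big_ord_recl IHk sqext_eval_const add0r.
Qed.

Lemma prod_tuple_bool_cons (k : nat) (G : k.+1.-tuple bool -> R) :
  \prod_e G e = \prod_(e : k.-tuple bool) (G [tuple of false :: e] * G [tuple of true :: e]).
Proof.
rewrite (reindex (fun p : bool * k.-tuple bool => [tuple of p.1 :: p.2])) /=.
  rewrite -(pair_big predT predT (fun b (e : k.-tuple bool) => G [tuple of b :: e])) /=.
  by rewrite (exchange_big) /=; apply: eq_bigr => e _; rewrite big_bool mulrC.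
exists (fun t => (thead t, [tuple of behead t])) => [[b t] _|t _] /=.
  by congr pair; apply: val_inj.
by rewrite -tuple_eta.
Qed.

Definition flip_signs k (e : k.-tuple bool) (v : 'I_k -> R) : 'I_k -> R :=
  fun i => (-1) ^+ tnth e i * v i.

(** Each elimination step evaluates to [(x1 + v_0 * x2) * (x1 - v_0 * x2)], so the norm is the
    product over all conjugates, even though the [v_i] lie in [R] itself. *)
Lemma sqext_norm_prod k v w (x : sqext R k) : (forall i, v i ^+ 2 = w i) ->
  sqext_norm w x = \prod_e sqext_eval (flip_signs e v) x.
Proof.
elim: k v w x => [|k IHk] v w x vw.
  rewrite (eq_bigl (pred1 [tuple])) ?big_pred1_eq // => e.
  by rewrite [e]tuple0 /= eqxx.
case: x => x1 x2.
pose v' i := v (lift ord0 i).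
have v'w i : v' i ^+ 2 = w (lift ord0 i) by rewrite vw.
rewrite prod_tuple_bool_cons /= (IHk v') //; apply: eq_bigr => e _.
have v'we i : flip_signs e v' i ^+ 2 = w (lift ord0 i).
  by rewrite /flip_signs exprMn -exprM muln2 -mul2n exprM sqrrN !expr1n mul1r v'w.
have E b : (fun i => flip_signs [tuple of b :: e] v (lift ord0 i)) =1 flip_signs e v'.
  by move=> i; rewrite /flip_signs tnthS.
have F b : flip_signs [tuple of b :: e] v ord0 = (-1) ^+ b * v ord0.
  by rewrite /flip_signs tnth0.
rewrite !(eq_sqext_eval (E _)) !F expr0 expr1.
rewrite sqext_eval_add sqext_eval_scale !(@sqext_eval_mul _ (flip_signs e v')) //.
rewrite -(vw ord0); ring.
Qed.

End SquareRootTower.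

(** With [a i * z] for [a i], the second factor is, up to the constant [b], the derivative in [z] of
    the linear form along a branch of the roots; the first clears denominators. *)
Lemma sqext_eval_jac (F : fieldType) k (v a : 'I_k -> F) : (forall i, v i != 0) ->
  sqext_eval v (sqext_jac a) = (\prod_i v i) * (1 + \sum_i a i / v i).
Proof.
elim: k v a => [|k IHk] v a v0 /=; first by rewrite !big_ord0 addr0 mul1r.
rewrite !big_ord_recl sqext_eval_scale sqext_eval_prod IHk //=.
by field; exact: v0.
Qed.

(** * Transport of norms along relations *)

Section Relations.
Variables (R1 R2 : comNzRingType) (rel : R1 -> R2 -> Prop).
Hypothesis rel0 : rel 0 0.
Hypothesis rel1 : rel 1 1.
Hypothesis relN : forall x y, rel x y -> rel (- x) (- y).
Hypothesis relD : forall x y x' y', rel x y -> rel x' y' -> rel (x + x') (y + y').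
Hypothesis relM : forall x y x' y', rel x y -> rel x' y' -> rel (x * x') (y * y').

(** One induction serves three relations: evaluation at a point, image under a ring morphism, and
    congruence modulo a power of ['X - z%:P]. *)
Fixpoint sqext_rel k : sqext R1 k -> sqext R2 k -> Prop :=
  if k is k'.+1 then fun x y => sqext_rel x.1 y.1 /\ sqext_rel x.2 y.2
  else rel.

Lemma sqext_rel_const k c d : rel c d -> sqext_rel (sqext_const k c) (sqext_const k d).
Proof. by elim: k c d => [//|k IHk] c d cd; split; apply: IHk. Qed.

Lemma sqext_rel_add k (x x' : sqext R1 k) (y y' : sqext R2 k) :
  sqext_rel x y -> sqext_rel x' y' -> sqext_rel (sqext_add x x') (sqext_add y y').
Proof.
elim: k x x' y y' => [|k IHk] x x' y y' /=; first exact: relD.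
by move=> [? ?] [? ?]; split; apply: IHk.
Qed.

Lemma sqext_rel_scale k c d (x : sqext R1 k) (y : sqext R2 k) :
  rel c d -> sqext_rel x y -> sqext_rel (sqext_scale c x) (sqext_scale d y).
Proof.
elim: k x y => [|k IHk] x y /= cd; first exact: relM.
by move=> [? ?]; split; apply: IHk.
Qed.

Lemma sqext_rel_mul k w u (x x' : sqext R1 k) (y y' : sqext R2 k) :
  (forall i, rel (w i) (u i)) -> sqext_rel x y -> sqext_rel x' y' ->
  sqext_rel (sqext_mul w x x') (sqext_mul u y y').
Proof.
elim: k w u x x' y y' => [|k IHk] w u x x' y y' wu /=; first exact: relM.
move=> [? ?] [? ?]; split; apply: sqext_rel_add; try exact: IHk.
by apply: sqext_rel_scale => //; apply: IHk.
Qed.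

Lemma sqext_rel_norm k w u (x : sqext R1 k) (y : sqext R2 k) :
  (forall i, rel (w i) (u i)) -> sqext_rel x y -> rel (sqext_norm w x) (sqext_norm u y).
Proof.
elim: k w u x y => [//|k IHk] w u x y wu /= [xy1 xy2]; apply: IHk => //.
apply: sqext_rel_add; first exact: sqext_rel_mul.
apply: sqext_rel_scale; first exact: relN.
exact: sqext_rel_mul.
Qed.

Lemma sqext_rel_lin k c d : rel c d -> sqext_rel (sqext_lin k c) (sqext_lin k d).
Proof.
by elim: k c d => [//|k IHk] c d cd; split; [apply: IHk|apply: sqext_rel_const].
Qed.

Lemma sqext_rel_prod k : sqext_rel (sqext_prod R1 k) (sqext_prod R2 k).
Proof. by elim: k => [//|k IHk]; split=> //; apply: sqext_rel_const. Qed.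

Lemma sqext_rel_jac k a b : (forall i, rel (a i) (b i)) ->
  sqext_rel (@sqext_jac R1 k a) (@sqext_jac R2 k b).
Proof.
elim: k a b => [//|k IHk] a b ab; split; last by apply: IHk => i; apply: ab.
by apply: sqext_rel_scale => //; apply: sqext_rel_prod.
Qed.

End Relations.

(** * Degree bounds for norms *)

Section Degree.
Variable R : comNzRingType.

(* The weight of [z^d * prod_(i in S) v_i] is [d + #|S|]; [sqext_weight j r x]
   says that [x] times a monomial of weight [j] has weight at most [r]. *)
Fixpoint sqext_weight k (j r : nat) : sqext {poly R} k -> Prop :=
  if k is k'.+1 then fun x => sqext_weight j r x.1 /\ sqext_weight j.+1 r x.2
  else fun p => p = 0 \/ (size p + j <= r.+1)%N.

Lemma sqext_weight_const0 k j r : @sqext_weight k j r (sqext_const k 0).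
Proof. by elim: k j => [|k IHk] j /=; [left|split]. Qed.

Lemma sqext_weight_const1 k j r : (j <= r)%N -> @sqext_weight k j r (sqext_const k 1).
Proof.
elim: k j => [|k IHk] j jr /=; first by right; rewrite size_poly1; lia.
by split; [apply: IHk|apply: sqext_weight_const0].
Qed.

Lemma sqext_weight_add k j r (x y : sqext {poly R} k) :
  sqext_weight j r x -> sqext_weight j r y -> sqext_weight j r (sqext_add x y).
Proof.
elim: k j x y => [|k IHk] j x y /=; last by move=> [? ?] [? ?]; split; apply: IHk.
move=> [->|sx] [->|sy]; rewrite ?addr0 ?add0r; [by left|by right|by right|right].
apply: leq_trans (leq_add (size_polyD _ _) (leqnn j)) _.
by rewrite addn_maxl geq_max sx.
Qed.

Lemma sqext_weight_scale k j r (c : {poly R}) (x : sqext {poly R} k) : (size c <= 3)%N ->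
  sqext_weight j.+2 r x -> sqext_weight j r (sqext_scale c x).
Proof.
move=> sc; elim: k j x => [|k IHk] j x /=; last by move=> [? ?]; split; apply: IHk.
move=> [->|sx]; first by left; rewrite mulr0.
right; apply: leq_trans (leq_add (size_polyMleq _ _) (leqnn j)) _.
by move: sc sx; move: (size c) (size x) => a b; lia.
Qed.

Lemma sqext_weight_mul k j r j' r' (w : 'I_k -> {poly R}) (x y : sqext {poly R} k) :
  (forall i, size (w i) <= 3)%N -> sqext_weight j r x -> sqext_weight j' r' y ->
  sqext_weight (j + j') (r + r') (sqext_mul w x y).
Proof.
elim: k j j' w x y => [|k IHk] j j' w x y sw /=.
  move=> [->|sx]; first by left; rewrite mul0r.
  move=> [->|sy]; first by left; rewrite mulr0.
  have [->|x0] := eqVneq x 0; first by left; rewrite mul0r.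
  have [->|y0] := eqVneq y 0; first by left; rewrite mulr0.
  right; apply: leq_trans (leq_add (size_polyMleq _ _) (leqnn _)) _.
  move: x0 y0 sx sy; rewrite -!size_poly_gt0.
  by move: (size x) (size y) => a b; lia.
move=> [x1 x2] [y1 y2]; split; apply: sqext_weight_add.
- exact: IHk.
- apply: sqext_weight_scale => //.
  have -> : (j + j').+2 = (j.+1 + j'.+1)%N by lia.
  exact: IHk.
- by rewrite -addnS; apply: IHk.
- by rewrite -addSn; apply: IHk.
Qed.

(** Replacing [v_i ^+ 2] by a radicand of degree at most 2 does not raise weights, and weights add
    under products; so each norm step doubles the bound, and at the end weight is degree. *)
Lemma sqext_weight_norm k r (w : 'I_k -> {poly R}) (x : sqext {poly R} k) :
  (forall i, size (w i) <= 3)%N ->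
  sqext_weight 0 r x -> (size (sqext_norm w x) <= (2 ^ k * r).+1)%N.
Proof.
elim: k r w x => [|k IHk] r w x sw /=; first by case=> [->|]; rewrite ?size_poly0; lia.
move=> [x1 x2]; have -> : (2 ^ k.+1 * r = 2 ^ k * (r + r))%N by rewrite expnS; lia.
apply: IHk => //; apply: sqext_weight_add.
  exact: (@sqext_weight_mul _ 0 r 0 r).
apply: sqext_weight_scale; first by rewrite size_polyN.
exact: (@sqext_weight_mul _ 1 r 1 r).
Qed.

Lemma sqext_weight_lin k (c : {poly R}) : (size c <= 2)%N -> @sqext_weight k 0 1 (sqext_lin k c).
Proof.
move=> sc; elim: k => [|k IHk] /=; first by right; rewrite addn0.
by split=> //; apply: sqext_weight_const1.
Qed.

End Degree.

(** * The elimination polynomial *)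

(* [map_resultant] of mxpoly only covers morphisms out of a polynomial ring. *)
Lemma rmorph_resultant (A B : nzRingType) (f : {rmorphism A -> B}) (p q : {poly A}) :
  f (lead_coef p) != 0 -> f (lead_coef q) != 0 ->
  f (resultant p q) = resultant (map_poly f p) (map_poly f q).
Proof.
move=> fp0 fq0; rewrite -det_map_mx /= /resultant /Sylvester_mx !size_map_poly_id0 //.
rewrite map_col_mx; congr (\det (col_mx _ _)); apply: map_lin1_mx => v;
  by rewrite map_poly_rV rmorphM /= map_rVpoly.
Qed.

(* Replacing [q] by [q + p * 'X^N] makes both leading coefficients equal to
   that of [p], so that the resultant commutes with specialization. *)
Lemma coprimep_locus (A : idomainType) (F : fieldType) (p q : {poly A}) :
  exists P : A, forall f : {rmorphism A -> F},
    (f P != 0) = (f (lead_coef p) != 0) && coprimep (map_poly f p) (map_poly f q).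
Proof.
pose q' := 'X^(size q) * p + q.
exists (lead_coef p * resultant p q') => f.
rewrite rmorphM mulf_eq0 negb_or; have [fp0/=|//] := boolP (f (lead_coef p) != 0).
have p0 : p != 0 by apply: contraNneq fp0 => ->; rewrite lead_coef0 rmorph0.
have lq' : lead_coef q' = lead_coef p.
  rewrite /q' lead_coefDl ?lead_coefM ?lead_coefXn ?mul1r //.
  by rewrite mulrC size_mulXn // -addn1 leq_add2l lt0n size_poly_eq0.
rewrite rmorph_resultant ?lq' // resultant_eq0 /q' rmorphD rmorphM /= map_polyXn.
rewrite -(coprimep_addl_mul 'X^(size q)) coprimep_def -leqNgt eqn_leq.
suff -> : (0 < size (gcdp (map_poly f p) ('X^(size q) * map_poly f p + map_poly f q)))%N.
  by rewrite andbT.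
by rewrite size_poly_gt0 gcdp_eq0 map_poly_eq0_id0 // (negPf p0).
Qed.

Lemma hensel_sqrt (F : numFieldType) (w : {poly F}) (z v : F) N :
  v != 0 -> v ^+ 2 = w.[z] ->
  exists V : {poly F}, V.[z] = v /\ ('X - z%:P) ^+ N.+1 %| V ^+ 2 - w.
Proof.
move=> v0 vw; elim: N => [|N [V [Vz /dvdpP [g Vg]]]].
  exists v%:P; rewrite hornerC expr1 dvdp_XsubCl rootE; split=> //.
  by rewrite hornerD hornerN -polyC_exp hornerC vw subrr.
(* If the error is [g * d], the correction by [c * d] turns it into
   [d * (g - 2 * c * V + c ^+ 2 * d)]; this [c] makes the cofactor vanish at [z]. *)
exists (V - (g.[z] / (2 * v)) *: ('X - z%:P) ^+ N.+1).
have Xz : (('X - z%:P) ^+ N.+1).[z] = 0 :> F by rewrite horner_exp hornerXsubC subrr expr0n.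
split; first by rewrite hornerD hornerN hornerZ Xz mulr0 subr0.
set c := _ / _; set d := _ ^+ N.+1 in Vg Xz *.
have -> : (V - c *: d) ^+ 2 - w = d * (g - (2 * c) *: V + c ^+ 2 *: d).
  have -> : w = V ^+ 2 - g * d by rewrite -Vg; ring.
  by rewrite -!mul_polyC (polyCM 2 c) (polyC_exp 2 c) polyC_natr; ring.
rewrite exprS -/d mulrC dvdp_mul2l; last first.
  by rewrite /d expf_neq0 // polyXsubC_eq0.
rewrite dvdp_XsubCl rootE !hornerD hornerN !hornerZ Xz Vz /c.
by apply/eqP; field.
Qed.

Section EliminationPolynomial.
Variable m : nat.

Section Ring.
Variables (R : comNzRingType) (b : R) (a : 'I_m -> R).

(* With [z] the value of V_0 and [v_i = b * V_i], the system reads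
   [v_i ^+ 2 = branch_sq i] and [b * (z + m - 1) + \sum_i v_i = 0]. *)
Definition branch_sq (i : 'I_m) : {poly R} :=
  (b ^+ 2)%:P + (b * a i) *: ('X^2 - 1).

Definition elim_poly : {poly R} :=
  sqext_norm branch_sq (sqext_lin m (b *: ('X + (m%:R - 1)%:P))).

(** Away from its zeros no [v_i] vanishes and, for nonzero [b], the linear form has nonzero
    derivative in [z] on every branch of the roots. *)
Definition ram_poly : {poly R} :=
  \prod_i branch_sq i * sqext_norm branch_sq (sqext_jac (fun i => a i *: 'X)).

Lemma size_branch_sq i : (size (branch_sq i) <= 3)%N.
Proof.
apply: leq_trans (size_polyD _ _) _; rewrite geq_max.
rewrite (leq_trans (size_polyC_leq1 _)) //=.
apply: leq_trans (size_scale_leq _ _) _.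
by apply: leq_trans (size_polyD _ _) _; rewrite size_polyN size_polyXn size_poly1.
Qed.

Lemma size_elim_poly_leq : (size elim_poly <= (2 ^ m).+1)%N.
Proof.
rewrite -[(2 ^ m)%N]muln1; apply: sqext_weight_norm; first exact: size_branch_sq.
apply: sqext_weight_lin; apply: leq_trans (size_scale_leq _ _) _.
by rewrite size_XaddC.
Qed.

End Ring.

Section Morphism.
Variables (R S : comNzRingType) (f : {rmorphism R -> S}) (b : R) (a : 'I_m -> R).

Let map_branch_sq i :
  map_poly f (branch_sq b a i) = branch_sq (f b) (f \o a) i.
Proof.
rewrite /branch_sq rmorphD /= map_polyC map_polyZ /= rmorphB /= map_polyXn rmorph1.
by rewrite (rmorphXn f) (rmorphM f).
Qed.

Lemma map_elim_poly : map_poly f (elim_poly b a) = elim_poly (f b) (f \o a).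
Proof.
apply: (@sqext_rel_norm _ _ (fun x y => map_poly f x = y)).
- by move=> x y <-; rewrite rmorphN.
- by move=> x y x' y' <- <-; rewrite rmorphD.
- by move=> x y x' y' <- <-; rewrite rmorphM.
- exact: map_branch_sq.
apply: sqext_rel_lin; rewrite ?rmorph0 ?rmorph1 //.
by rewrite map_polyZ rmorphD /= map_polyX map_polyC /= rmorphB rmorph1 rmorph_nat.
Qed.

Lemma map_ram_poly : map_poly f (ram_poly b a) = ram_poly (f b) (f \o a).
Proof.
rewrite rmorphM rmorph_prod /=; congr (_ * _).
  by apply: eq_bigr => i _; apply: map_branch_sq.
apply: (@sqext_rel_norm _ _ (fun x y => map_poly f x = y)).
- by move=> x y <-; rewrite rmorphN.
- by move=> x y x' y' <- <-; rewrite rmorphD.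
- by move=> x y x' y' <- <-; rewrite rmorphM.
- exact: map_branch_sq.
apply: sqext_rel_jac => [|||i].
- by rewrite rmorph0.
- by rewrite rmorph1.
- by move=> x y x' y' <- <-; rewrite rmorphM.
- by rewrite map_polyZ map_polyX.
Qed.

End Morphism.

Section Witness.
Variables (F : fieldType) (a : 'I_m -> F).
Hypothesis a0 : forall i, a i = 0.

Let branch_sq1 i : (1 : {poly F}) ^+ 2 = branch_sq 1 a i.
Proof. by rewrite /branch_sq a0 mulr0 scale0r addr0 !expr1n. Qed.

(** All radicands are 1, so every [v_i] is a sign and the norm is a product of [2 ^ m] monic linear
    factors. *)
Lemma size_elim_poly_witness : size (elim_poly 1 a) = (2 ^ m).+1.
Proof.
rewrite /elim_poly (sqext_norm_prod _ branch_sq1).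
pose c (e : m.-tuple bool) : F := m%:R - 1 + \sum_i (-1) ^+ tnth e i.
rewrite (eq_bigr (fun e : m.-tuple bool => 'X - (- c e)%:P)) => [|e _].
  by rewrite size_prod_XsubC -sum1_size sum1_card card_tuple card_bool.
rewrite sqext_eval_lin scale1r polyCN opprK -addrA /c (polyCD (m%:R - 1)).
congr (_ + (_ + _)).
by rewrite rmorph_sum; apply: eq_bigr => i _; rewrite /flip_signs mulr1 rmorphXn rmorphN1.
Qed.

Lemma size_ram_poly_witness : size (ram_poly 1 a) = 1%N.
Proof.
apply/eqP; rewrite size_poly_eq1 /ram_poly.
rewrite (eq_bigr (fun=> 1)) => [|i _]; last by rewrite -branch_sq1 expr1n.
rewrite big1_eq mul1r (sqext_norm_prod _ branch_sq1).
have sgn_eqp1 (c : bool) : (-1) ^+ c %= (1 : {poly F}).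
  case: c; rewrite ?expr1 ?expr0 ?eqpxx //.
  by rewrite -scaleN1r eqp_scale // oppr_eq0 oner_neq0.
apply: (big_ind (fun p : {poly F} => p %= 1)) => [|x y x1 y1|e _].
- exact: eqpxx.
- by apply: eqp_trans (eqp_mulr y x1) _; rewrite mul1r.
(* With [a = 0] only the term [v_0 * ... * v_(m-1)] of the Jacobian element survives, here a product
   of signs. *)
rewrite [X in X %= _](_ : _ = \prod_i flip_signs e (fun=> 1) i).
  apply: (big_ind (fun p : {poly F} => p %= 1)) => [|x y x1 y1|i _].
  - exact: eqpxx.
  - by apply: eqp_trans (eqp_mulr y x1) _; rewrite mul1r.
  by rewrite /flip_signs mulr1.
rewrite -sqext_eval_prod; move: (flip_signs _ _); clear -a0.
elim: m a a0 => [//|k IHk] a' a'0 v /=.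
rewrite a'0 scale0r sqext_eval_scale mul0r sqext_eval_const; congr (_ + _ * _).
exact: IHk.
Qed.

End Witness.
End EliminationPolynomial.

(** * Counting the solutions of the quadric system *)

Lemma mup_prod (F : fieldType) (I : finType) (z : F) (f : I -> {poly F}) :
  (forall i, f i != 0) -> mup z (\prod_i f i) = (\sum_i mup z (f i))%N.
Proof.
move=> f0; suff [] : mup z (\prod_i f i) = (\sum_i mup z (f i))%N /\ \prod_i f i != 0 by [].
apply: (big_ind2 (fun (p : {poly F}) n => mup z p = n /\ p != 0)) => // [|p n q k [<- p0] [<- q0]].
  by rewrite oner_neq0 mupNroot // rootE hornerC oner_neq0.
by rewrite mupM // mulf_neq0.
Qed.

Lemma deriv_double_root (F : fieldType) (z : F) (p : {poly F}) :
  ('X - z%:P) ^+ 2 %| p -> p^`().[z] = 0.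
Proof.
case/dvdpP=> q ->; rewrite expr2 !derivM derivXsubC mul1r mulr1 !hornerE.
by rewrite /= subrr !mulr0 add0r add0r subrr mulr0.
Qed.

Lemma mup_simple_root (F : fieldType) (z : F) (p : {poly F}) :
  root p z -> p^`().[z] != 0 -> mup z p = 1%N.
Proof.
move=> pz dp0; have p0 : p != 0.
  by apply: contraNneq dp0 => ->; rewrite deriv0 horner0.
apply/eqP; rewrite eqn_leq mup_leq // -XsubC_dvd // dvdp_XsubCl pz andbT.
by apply: contra dp0 => /deriv_double_root ->.
Qed.

Lemma sum_count_mem_undup (T : eqType) (s : seq T) :
  (\sum_(x <- undup s) count_mem x s)%N = size s.
Proof.
rewrite -(perm_size (perm_count_undup s)) size_flatten /shape -map_comp sumnE big_map.
by apply: eq_bigr => x _; rewrite /= size_nseq.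
Qed.

Section Counting.
Variables (F : numClosedFieldType) (m : nat) (b : F) (a : 'I_m -> F).
Hypothesis b0 : b != 0.
Hypothesis size_elim : size (elim_poly b a) = (2 ^ m).+1.
Hypothesis coprime_elim : coprimep (elim_poly b a) (ram_poly b a).

Let w := branch_sq b a.
Let p := elim_poly b a.
Let c : F := m%:R - 1.

(** A square root fixed separately at each [z], with no regularity in [z]; [f z e] is the linear
    form at the sign choice [e]. *)
Let v z i := sqrtC (w i).[z].
Let f z e := b * (z + c) + \sum_i flip_signs e (v z) i.

Let v_sq z i : v z i ^+ 2 = (w i).[z].
Proof. exact: sqrtCK. Qed.

Let sgn_sq (x : bool) : ((-1) ^+ x) ^+ 2 = 1 :> F.
Proof. by rewrite -exprM mulnC exprM sqrrN !expr1n. Qed.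

Let norm_horner z (x : sqext {poly F} m) y :
  sqext_rel (fun (q : {poly F}) r => q.[z] = r) x y ->
  (sqext_norm w x).[z] = \prod_e sqext_eval (flip_signs e (v z)) y.
Proof.
move=> xy; rewrite -(@sqext_norm_prod _ _ _ (fun i => (w i).[z])) //.
apply: (@sqext_rel_norm _ _ (fun (q : {poly F}) r => q.[z] = r)) => //.
- by move=> q r <-; rewrite hornerN.
- by move=> q r q' r' <- <-; rewrite hornerD.
- by move=> q r q' r' <- <-; rewrite hornerM.
Qed.

Let elim_horner z : p.[z] = \prod_e f z e.
Proof.
rewrite (@norm_horner _ _ (sqext_lin m (b * (z + c)))).
  by apply: eq_bigr => e _; rewrite sqext_eval_lin.
apply: sqext_rel_lin; rewrite ?hornerC //.
by rewrite hornerZ hornerD hornerX hornerC.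
Qed.

Let elim_rootP z : reflect (exists e, f z e = 0) (root p z).
Proof.
rewrite rootE elim_horner; apply: (iffP eqP) => [/eqP/prodf_eq0[e _ /eqP]|[e fe]].
  by exists e.
by apply/eqP/prodf_eq0; exists e => //; apply/eqP.
Qed.

Let ram_root z : root p z -> (ram_poly b a).[z] != 0.
Proof. by move=> pz; have := coprimep_root coprime_elim pz. Qed.

Let w_neq0 z i : root p z -> (w i).[z] != 0.
Proof.
move/ram_root; rewrite hornerM mulf_eq0 negb_or horner_prod => /andP[w0 _].
by move/prodf_neq0: w0; apply.
Qed.

Let v_neq0 z i : root p z -> v z i != 0.
Proof. by move=> pz; rewrite sqrtC_eq0 w_neq0. Qed.

Let fv_neq0 z i (e : m.-tuple bool) : root p z -> flip_signs e (v z) i != 0.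
Proof. by move=> pz; rewrite mulf_neq0 ?v_neq0 // expf_neq0 // oppr_eq0 oner_neq0. Qed.

Let jac_neq0 z e : root p z ->
  1 + \sum_i a i * z / flip_signs e (v z) i != 0.
Proof.
move=> pz; have := ram_root pz; rewrite hornerM mulf_eq0 negb_or => /andP[_].
rewrite (@norm_horner _ _ (sqext_jac (fun i => a i * z))) => [/prodf_neq0/(_ e isT)|].
  by rewrite sqext_eval_jac ?mulf_eq0 ?negb_or => [/andP[]//|i]; apply: fv_neq0.
apply: sqext_rel_jac => [|||i]; rewrite ?hornerC //.
  by move=> q r q' r' <- <-; rewrite hornerM.
by rewrite hornerZ hornerX.
Qed.

(* Near [z] the [v_i] extend to power series, and the factors [f e] become
   power series with at most simple zeros at [z]. *)
Let mup_elim z : root p z -> mup z p = #|[set e | f z e == 0]|.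
Proof.
move=> pz; set N := (2 ^ m).+1.
have /fin_all_exists2[V Vz Vw] : forall i, exists2 V : {poly F},
    V.[z] = v z i & ('X - z%:P) ^+ N.+1 %| V ^+ 2 - w i.
  move=> i; have [V [Vz Vw]] := hensel_sqrt N (v_neq0 i pz) (v_sq z i).
  by exists V.
pose g (e : m.-tuple bool) : {poly F} := b *: ('X + c%:P) + \sum_i flip_signs e V i.
have gz e : (g e).[z] = f z e.
  rewrite hornerD hornerZ hornerD hornerX hornerC horner_sum; congr (_ + _).
  apply: eq_bigr => i _; rewrite hornerM Vz; congr (_ * _).
  by rewrite horner_exp hornerN hornerC.
(* Differentiate [V ^+ 2 = w] at [z]; the congruence modulo [('X - z%:P) ^+ 2] suffices. *)
have dV i : (V i)^`().[z] = b * (a i * z) / v z i.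
  have /deriv_double_root : ('X - z%:P) ^+ 2 %| V i ^+ 2 - w i.
    by apply: dvdp_trans (Vw i); apply: dvdp_exp2l.
  rewrite derivB /w /branch_sq expr2 derivM derivD derivC derivZ derivB derivXn derivC.
  rewrite !hornerE Vz => /eqP; rewrite subr_eq0 => /eqP E.
  apply: (mulIf (v_neq0 i pz)); rewrite divfK ?v_neq0 //.
  apply: (@mulfI _ 2); first by rewrite pnatr_eq0.
  have -> : 2 * ((V i)^`().[z] * v z i) =
     (V i)^`().[z] * v z i + v z i * (V i)^`().[z] by ring.
  by rewrite E /=; ring.
have dg e : (g e)^`().[z] = b * (1 + \sum_i a i * z / flip_signs e (v z) i).
  rewrite derivD derivZ derivD derivX derivC addr0 raddf_sum hornerD hornerZ hornerC.
  rewrite horner_sum mulrDr; congr (_ + _); rewrite mulr_sumr; apply: eq_bigr => i _.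
  rewrite /flip_signs; case: (tnth e i); rewrite ?expr0 ?expr1 ?mul1r ?mulN1r.
    by rewrite /= derivN hornerN dV; field; rewrite v_neq0.
  by rewrite /= dV; field; rewrite v_neq0.
have dg0 e : (g e)^`().[z] != 0 by rewrite dg mulf_neq0 // jac_neq0.
have mup_g e : mup z (g e) = (f z e == 0).
  have [fe|fe] := eqVneq (f z e) 0.
    by apply: mup_simple_root => //; rewrite rootE gz fe.
  by apply: mupNroot; rewrite rootE gz.
have g0 e : g e != 0 by apply: contraNneq (dg0 e) => ->; rewrite deriv0 horner0.
have mup_pg : mup z (\prod_e g e) = #|[set e | f z e == 0]|.
  by rewrite mup_prod // -sum1_card (eq_bigr _ (fun e _ => mup_g e)) -big_mkcond big_set.
have p0 : p != 0 by rewrite -size_poly_gt0 size_elim.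
(* The norm respects the congruence [V i ^+ 2 = w i], so the product agrees with [p] to an order
   exceeding the number [2 ^ m] of factors, which is enough to determine the multiplicity of [z]. *)
have pg : ('X - z%:P) ^+ N.+1 %| \prod_e g e - p.
  have -> : \prod_e g e = sqext_norm (fun i => V i ^+ 2) (sqext_lin m (b *: ('X + c%:P))).
    rewrite (@sqext_norm_prod _ _ V) //.
    by apply: eq_bigr => e _; rewrite sqext_eval_lin.
  set d := _ ^+ _; apply: (@sqext_rel_norm _ _ (fun x y => d %| x - y)) => //.
  - by move=> x y xy; rewrite -opprD dvdpNr.
  - by move=> x y x' y' xy xy'; rewrite opprD addrACA dvdp_add.
  - move=> x y x' y' xy xy'.
    have -> : x * x' - y * y' = (x - y) * x' + y * (x' - y') by ring.
    by apply: dvdp_add; [apply: dvdp_mulr|apply: dvdp_mull].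
  - by apply: sqext_rel_lin; rewrite subrr dvdp0.
have small : (#|[set e | f z e == 0%R]| < N)%N.
  rewrite ltnS; apply: leq_trans (max_card _) _.
  by rewrite card_tuple card_bool.
rewrite -mup_pg; apply/eqP; rewrite eqn_leq mup_leq // mup_geq //.
have pg' j : (j <= N.+1)%N -> (('X - z%:P) ^+ j %| p) = (('X - z%:P) ^+ j %| \prod_e g e).
  move=> jN; have := dvdp_trans (dvdp_exp2l ('X - z%:P) jN) pg.
  by move/dvdp_add_eq ->; rewrite dvdpNr.
have pg0 : \prod_e g e != 0 by apply/prodf_neq0.
rewrite !pg' ?mup_pg; try lia.
by rewrite -mup_ltn // -mup_geq // mup_pg ltnS leqnn.
Qed.

Definition quadric_system (V : {ffun 'I_m.+1 -> F}) : Prop :=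
  \sum_i V i = 1 - m%:R /\
  forall i, b * (V (lift ord0 i) ^+ 2 - 1) = a i * (V ord0 ^+ 2 - 1).

Let point z (e : m.-tuple bool) : {ffun 'I_m.+1 -> F} :=
  [ffun i => if unlift ord0 i is Some j then flip_signs e (v z) j / b else z].

Let point0 z e : point z e ord0 = z.
Proof. by rewrite ffunE unlift_none. Qed.

Let pointS z e i : point z e (lift ord0 i) = flip_signs e (v z) i / b.
Proof. by rewrite ffunE liftK. Qed.

Let v_sqE z i : v z i ^+ 2 = b ^+ 2 + b * a i * (z ^+ 2 - 1).
Proof.
rewrite v_sq /w /branch_sq.
by rewrite hornerD hornerZ hornerD hornerN hornerXn !hornerC.
Qed.

Let fv_sq z e i : flip_signs e (v z) i ^+ 2 = b ^+ 2 + b * a i * (z ^+ 2 - 1).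
Proof. by rewrite exprMn sgn_sq mul1r v_sqE. Qed.

Let point_sum z e : b * (\sum_i point z e i + m%:R - 1) = f z e.
Proof.
rewrite big_ord_recl point0 /f /c -addrA -addrA [_ + (m%:R - 1)]addrC addrA mulrDr.
congr (_ + _); rewrite mulr_sumr; apply: eq_bigr => i _.
by rewrite pointS mulrC divfK.
Qed.

Let point_system z e : f z e = 0 -> quadric_system (point z e).
Proof.
move=> fz; split.
  have /eqP := point_sum z e; rewrite fz mulf_eq0 (negPf b0) /= => /eqP E.
  apply/eqP; rewrite -subr_eq0; apply/eqP; rewrite -[RHS]E; ring.
move=> i; rewrite point0 pointS exprMn fv_sq; field.
exact: b0.
Qed.

Let system_point V : quadric_system V -> exists2 e, f (V ord0) e = 0 & V = point (V ord0) e.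
Proof.
case=> sumV sqV; set z := V ord0.
pose e := [tuple b * V (lift ord0 i) != v z i | i < m].
have VE : V = point z e.
  apply/ffunP=> j; case: (unliftP ord0 j) => [i|] ->; last by rewrite point0.
  rewrite pointS; apply: (mulIf b0); rewrite divfK // mulrC /flip_signs tnth_mktuple.
  have [->|ne] := eqVneq; first by rewrite mul1r.
  have /eqP : (b * V (lift ord0 i)) ^+ 2 = v z i ^+ 2.
    by rewrite v_sqE -mulrA -sqV; ring.
  by rewrite eqf_sqr (negPf ne) /= mulN1r => /eqP.
exists e => //; rewrite -point_sum -VE sumV; ring.
Qed.

Theorem card_quadric_system : has_card quadric_system (2 ^ m).
Proof.
have p0 : p != 0 by rewrite -size_poly_gt0 size_elim.
have [rs prs] := closed_field_poly_normal p.
have rsE z : (z \in rs) = root p z.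
  by rewrite prs rootZ ?lead_coef_eq0 // root_prod_XsubC.
have mup_rs z : mup z p = count_mem z rs.
  rewrite prs -mul_polyC mupMr ?mu_prod_XsubC //.
  by rewrite rootC lead_coef_eq0.
have size_rs : size rs = (2 ^ m)%N.
  have := size_elim; rewrite -/p prs size_scale ?lead_coef_eq0 //.
  by rewrite size_prod_XsubC => -[].
pose es z := enum [set e | f z e == 0].
exists [seq point z e | z <- undup rs, e <- es z]; split.
(* Points over different roots differ in coordinate 0; over one root, different signs give different
   points because no [v z i] vanishes there. *)
- apply: allpairs_uniq_dep => [|z _|[z e] [z' e']]; rewrite ?undup_uniq ?enum_uniq //.
  case/allpairsPdep=> z1 [e1 [z1rs _ [-> ->]]] /= _ /= E.
  have zz' : z1 = z' by rewrite -(point0 z1 e1) E point0.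
  rewrite -zz' in E *; congr (Tagged _ _); apply/eq_from_tnth => i.
  move: z1rs; rewrite mem_undup rsE => z1p.
  have := congr1 (fun g : {ffun _} => g (lift ord0 i)) E; rewrite !pointS.
  move/(mulIf (invr_neq0 b0))/(mulIf (v_neq0 i z1p)).
  have N1 : (-1 != 1 :> F) by rewrite -subr_eq0 -opprD oppr_eq0 (pnatr_eq0 _ 2).
  by do 2!case: (tnth _ i) => //=; rewrite expr0 expr1 => /eqP;
    rewrite ?(negPf N1) // eq_sym (negPf N1).
- rewrite size_allpairs_dep sumnE big_map -size_rs -sum_count_mem_undup.
  apply: eq_big_seq => z; rewrite mem_undup rsE => pz.
  by rewrite -mup_rs mup_elim // cardE.
move=> V; split.
  case/allpairsPdep=> z [e [_]]; rewrite mem_enum inE => /eqP fz ->.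
  exact: point_system.
move=> /system_point[e fV ->]; apply/allpairsPdep; exists (V ord0), e.
rewrite mem_enum inE fV eqxx mem_undup rsE; split=> //.
by apply/elim_rootP; exists e.
Qed.

End Counting.

(** * The critical equations of the tree polynomial *)

Lemma has_card_bij (T1 T2 : eqType) (Q1 : T1 -> Prop) (Q2 : T2 -> Prop) g h d :
  (forall x, Q1 x -> Q2 (g x) /\ h (g x) = x) ->
  (forall y, Q2 y -> Q1 (h y) /\ g (h y) = y) ->
  has_card Q1 d -> has_card Q2 d.
Proof.
move=> gP hP [s [s_uniq <- sP]]; exists (map g s); split; last first.
- move=> y; split=> [/mapP[x /sP/gP[? _] ->] //|/hP[/sP yin gh]].
  by rewrite -gh map_f.
- by rewrite size_map.
rewrite map_inj_in_uniq // => x y /sP/gP[_ xE] /sP/gP[_ yE] gxy.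
by rewrite -xE -yE gxy.
Qed.

(** The weighted count of spanning trees of a cycle with [m.+1] edges: each tree omits one edge. *)
Definition tree_sum (R : comNzRingType) m (Y : 'I_m.+1 -> R) : R :=
  \sum_i \prod_(j | j != i) Y j.

Definition tree_sum_deriv (R : comNzRingType) m i (Y : 'I_m.+1 -> R) : R :=
  \sum_(j | j != i) \prod_(l | (l != i) && (l != j)) Y l.

Section TreeEquations.
Variables (F : numClosedFieldType) (m : nat).
Implicit Types (Y : 'I_m.+1 -> F) (s : 'I_m.+1 -> F).

Definition tree_critical s (Y : {ffun 'I_m.+1 -> F}) : Prop :=
  tree_sum Y != 0 /\ forall i, tree_sum_deriv i Y = s i * tree_sum Y.

Lemma tree_sum_inv Y : (forall i, Y i != 0) ->
  tree_sum Y = \prod_i Y i * \sum_i (Y i)^-1.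
Proof.
move=> Y0; rewrite mulr_sumr; apply: eq_bigr => i _.
by rewrite [in RHS](bigD1 i) //= mulrAC divff // mul1r.
Qed.

Lemma tree_sum_deriv_inv i Y : (forall i, Y i != 0) ->
  tree_sum_deriv i Y =
  \prod_i Y i * ((Y i)^-1 * (\sum_j (Y j)^-1 - (Y i)^-1)).
Proof.
move=> Y0; rewrite [X in X - _](bigD1 i) //= [_ + \sum_(_ | _) _]addrC addrK.
rewrite !mulr_sumr; apply: eq_bigr => j ji.
rewrite [in RHS](bigD1 i) //= [in RHS](bigD1 j) //=.
by field; rewrite !Y0.
Qed.

(** If [Y i = 0], the derivative at [j != i] keeps only the product omitting [i] and [j]. Summing
    over [j] gives the derivative at [i], so [s i] would be the sum of the other [s j]. *)
Lemma tree_critical_neq0 s (Y : {ffun 'I_m.+1 -> F}) :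
  (forall i, s i != \sum_(j | j != i) s j) -> tree_critical s Y ->
  forall i, Y i != 0.
Proof.
move=> s_neq [E0 crit] i; apply: contra_neq (s_neq i) => Yi0.
apply: (mulIf E0); rewrite -crit mulr_suml; apply: eq_bigr => j ji.
rewrite -crit /tree_sum_deriv [RHS](bigD1 i) 1?eq_sym //= [X in _ + X]big1 ?addr0.
  by apply: eq_bigl => l; rewrite andbC.
move=> l /andP[lj li]; apply/eqP/prodf_eq0; exists i; last by rewrite Yi0.
by rewrite eq_sym ji eq_sym.
Qed.

Variable s : 'I_m.+1 -> F.
Hypothesis s_neq0 : forall i, s i != 0.
Hypothesis s_neq : forall i, s i != \sum_(j | j != i) s j.
Let system := quadric_system (s ord0) (fun i : 'I_m => s (lift ord0 i)).

Let system_sum V : system V -> \sum_i (1 + V i) = 2.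
Proof.
case=> sumV _; rewrite big_split sumV /= sumr_const card_ord -natr1 addrC.
by rewrite -addrA; ring.
Qed.

Let system_sq V i : system V ->
  s ord0 * (V i ^+ 2 - 1) = s i * (V ord0 ^+ 2 - 1).
Proof. by case=> _ sqV; case: (unliftP ord0 i) => [j|] ->. Qed.

(** If [V_0 ^+ 2 = 1], all [V_i] are signs since [s_0] is nonzero, and [\sum_i (1 + V i) = 2] says
    that exactly one is 1. *)
Let card_trivial_points L : uniq L -> (forall V, V \in L <-> system V) ->
  count (fun V : {ffun 'I_m.+1 -> F} => V ord0 ^+ 2 == 1) L = m.+1.
Proof.
move=> uL LP.
pose t (i : 'I_m.+1) : {ffun 'I_m.+1 -> F} := [ffun j => (-1) ^+ (j != i)].
have t_sq i j : t i j ^+ 2 = 1.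
  by rewrite ffunE -exprM mulnC exprM sqrrN !expr1n.
have N1 : (-1 != 1 :> F) by rewrite -subr_eq0 -opprD oppr_eq0 (pnatr_eq0 _ 2).
have t_sys i : system (t i).
  split; last by move=> j; rewrite !t_sq !subrr !mulr0.
  rewrite (bigD1 i) //= ffunE eqxx expr0 (eq_bigr (fun=> -1)) => [|j ji].
    by rewrite sumr_const cardC1 card_ord mulNrn.
  by rewrite ffunE ji expr1.
rewrite -size_filter -[RHS](size_enum_ord m.+1) -(size_map t); apply: perm_size.
apply: uniq_perm; first exact: filter_uniq.
  rewrite map_inj_uniq ?enum_uniq // => i j /ffunP/(_ i).
  rewrite !ffunE eqxx expr0; case: eqP => // _ /eqP.
  by rewrite expr1 eq_sym (negPf N1).
move=> V; rewrite mem_filter; apply/andP/mapP => [[/eqP V0 /LP sysV]|[i _ ->]]; last first.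
  by rewrite t_sq eqxx; split=> //; apply/LP.
have V1 i : V i = 1 \/ V i = -1.
  have /eqP := system_sq i sysV; rewrite V0 subrr mulr0 mulf_eq0 (negPf (s_neq0 _)) /=.
  by rewrite subr_eq0 sqrf_eq1 => /orP[] /eqP; [left|right].
have card1 : #|[pred i | V i == 1]| = 1%N.
  have := system_sum sysV; rewrite (eq_bigr (fun i => (V i == 1)%:R * 2)) => [|i _].
    rewrite -mulr_suml -natr_sum -big_mkcond sum1_card -[RHS]mul1r.
    move/(mulIf (_ : 2 != 0)); rewrite pnatr_eq0 => /(_ isT)/eqP.
    by rewrite (eqr_nat _ _ 1) => /eqP.
  case: (V1 i) => ->; rewrite ?eqxx ?(negPf N1) ?mul0r ?mul1r //.
  by rewrite subrr.
have [i Vi] := mem_card1 card1.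
exists i; rewrite ?mem_enum //; apply/ffunP=> j; rewrite ffunE.
have := Vi j; rewrite !inE; case: (V1 j) => ->; rewrite ?eqxx ?(negPf N1).
  by move/esym->.
by move/esym->.
Qed.

Lemma card_nontrivial_points : has_card system (2 ^ m) ->
  has_card (fun V => system V /\ V ord0 ^+ 2 != 1) (2 ^ m - m.+1).
Proof.
case=> L [uL sizeL LP].
exists [seq V : {ffun 'I_m.+1 -> F} <- L | V ord0 ^+ 2 != 1]; split.
- exact: filter_uniq.
- have := count_predC (fun V : {ffun 'I_m.+1 -> F} => V ord0 ^+ 2 == 1) L.
  by rewrite (card_trivial_points uL LP) size_filter sizeL => <-; rewrite addKn.
move=> V; rewrite mem_filter; split=> [/andP[? /LP]|[/LP ? ->]] //.
Qed.

(** This is [1 / Y_i = Q * (1 + V_i) / 2] with [Q = 4 * s_0 / (1 - V_0 ^+ 2)], the value of [Q] that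
    the critical equation at index 0 forces. *)
Let to_tree (V : {ffun 'I_m.+1 -> F}) : {ffun 'I_m.+1 -> F} :=
  [ffun i => (1 - V ord0 ^+ 2) / (2 * s ord0 * (1 + V i))].

Let of_tree (Y : {ffun 'I_m.+1 -> F}) : {ffun 'I_m.+1 -> F} :=
  [ffun i => 2 * (Y i)^-1 / (\sum_j (Y j)^-1) - 1].

Lemma card_tree_critical : has_card system (2 ^ m) ->
  has_card (tree_critical s) (2 ^ m - m.+1).
Proof.
move/card_nontrivial_points; apply: (has_card_bij (g := to_tree) (h := of_tree)).
  move=> V [sysV V0].
  have t0 : 1 - V ord0 ^+ 2 != 0 by rewrite subr_eq0 eq_sym.
  have V1 i : 1 + V i != 0.
    apply: contraNneq t0 => Vi; have := system_sq i sysV.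
    have -> : V i = -1 by apply/eqP; rewrite -addr_eq0 addrC Vi.
    rewrite sqrrN expr1n subrr mulr0 => /esym/eqP; rewrite mulf_eq0 (negPf (s_neq0 _)) /=.
    by rewrite -opprB oppr_eq0.
  pose Q := 4 * s ord0 / (1 - V ord0 ^+ 2).
  have n2 : (2 : F) != 0 by rewrite pnatr_eq0.
  have n4 : (4 : F) != 0 by rewrite pnatr_eq0.
  have Q0 : Q != 0 by rewrite !mulf_neq0 ?invr_neq0.
  have YE i : (to_tree V i)^-1 = Q * (1 + V i) / 2.
    by rewrite ffunE /Q; field; rewrite ?n2 ?V1 ?t0 ?s_neq0.
  have Y0 i : to_tree V i != 0 by rewrite -invr_eq0 YE !mulf_neq0 ?invr_neq0.
  have sumY : \sum_i (to_tree V i)^-1 = Q.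
    rewrite (eq_bigr _ (fun i _ => YE i)) -mulr_suml -mulr_sumr system_sum //.
    by rewrite mulfK.
  split; last by apply/ffunP=> i; rewrite ffunE YE sumY; field; rewrite ?n2 ?Q0.
  split; first by rewrite tree_sum_inv // sumY mulf_neq0 //; apply/prodf_neq0.
  move=> i; rewrite tree_sum_inv // tree_sum_deriv_inv // sumY YE [RHS]mulrCA; congr (_ * _).
  have sq := system_sq i sysV.
  have -> : s i = s ord0 * (1 - V i ^+ 2) / (1 - V ord0 ^+ 2).
    by apply: (mulIf t0); rewrite divfK // -opprB mulrN -sq -mulrN opprB.
  by rewrite /Q; field; rewrite ?n2 ?t0.
move=> Y critY; have Y0 := tree_critical_neq0 s_neq critY.
case: critY => E0 crit; set Q := \sum_j (Y j)^-1.
have P0 : \prod_i Y i != 0 by apply/prodf_neq0.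
have Q0 : Q != 0 by move: E0; rewrite tree_sum_inv // mulf_eq0 negb_or => /andP[].
have n2 : (2 : F) != 0 by rewrite pnatr_eq0.
have n4 : (4 : F) != 0 by rewrite pnatr_eq0.
have eqs i : (Y i)^-1 * (Q - (Y i)^-1) = s i * Q.
  apply: (mulfI P0); rewrite -tree_sum_deriv_inv // crit tree_sum_inv //.
  by rewrite mulrCA.
have VE i : of_tree Y i = 2 * (Y i)^-1 / Q - 1 by rewrite ffunE.
have VS i : 1 - of_tree Y i ^+ 2 = 4 * s i / Q.
  apply: (mulIf Q0); rewrite divfK //.
  have -> : 4 * s i = 4 * (s i * Q) / Q by field.
  by rewrite -eqs VE; field; rewrite ?Q0 ?Y0.
split; last first.
  apply/ffunP=> i; rewrite ffunE VS VE addrC subrK.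
  by field; rewrite ?n2 Q0 Y0 s_neq0.
split; last first.
  by rewrite -subr_eq0 -oppr_eq0 opprB VS !mulf_neq0 ?invr_neq0.
split=> [|i].
  rewrite (eq_bigr _ (fun i _ => VE i)) sumrB sumr_const card_ord -mulr_suml -mulr_sumr.
  by rewrite mulfK // -natr1; ring.
by rewrite -[X in _ * X]opprB -[X in _ = _ * X]opprB !VS; ring.
Qed.

End TreeEquations.

(** * Critical points and change of basis *)

Section DetDerivative.
Variable F : fieldType.

(** The derivative of [\det] at [A] in the direction [B], in Leibniz form. *)
Definition det_deriv m (A B : 'M[F]_m) : F :=
  \sum_(t : 'S_m) (-1) ^+ t * \sum_i B i (t i) * \prod_(j | j != i) A j (t j).

Fact det_deriv_is_linear m (A : 'M[F]_m) : scalar (det_deriv A).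
Proof.
move=> c B C; rewrite /det_deriv mulr_sumr -big_split; apply: eq_bigr => t _ /=.
rewrite mulrCA -mulrDr; congr (_ * _).
rewrite mulr_sumr -big_split; apply: eq_bigr => i _ /=.
by rewrite !mxE; ring.
Qed.

HB.instance Definition _ m (A : 'M[F]_m) :=
  GRing.isLinear.Build F 'M[F]_m F _ (det_deriv A) (det_deriv_is_linear A).

Lemma mderiv_prod r k m (p : 'I_m -> {mpoly F[r]}) :
  mderiv k (\prod_i p i) = \sum_i mderiv k (p i) * \prod_(j | j != i) p j.
Proof.
elim: m p => [|m IHm] p; first by rewrite !big_ord0 mderivC.
rewrite !big_ord_recl mderivM IHm; congr (_ + _).
  by congr (_ * _); rewrite [RHS]big_mkcond big_ord_recl /= mul1r.
rewrite mulr_sumr; apply: eq_bigr => i _; rewrite mulrCA; congr (_ * _).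
rewrite [RHS]big_mkcond big_ord_recl /=; congr (_ * _); rewrite -big_mkcond /=.
by apply: eq_bigl => j; rewrite (inj_eq lift_inj).
Qed.

Lemma mderivXU r (k i : 'I_r) : mderiv k 'X_i = (i == k)%:R%:MP :> {mpoly F[r]}.
Proof.
rewrite mderivX mnm1E; case: eqP => [->|_]; last by rewrite scale0r mpolyC0.
by rewrite scale1r -{1}[U_(k)%MM]add0m addmK mpolyX0.
Qed.

Variables (m r : nat) (K : r.-tuple 'M[F]_m).

Definition combination (x : 'I_r -> F) : 'M[F]_m := \sum_i x i *: tnth K i.

Let entry (i j : 'I_m) : {mpoly F[r]} := \sum_k tnth K k i j *: 'X_k.

Let det_polyE : det_poly K = \det (\matrix_(i, j) entry i j).
Proof.
congr (\det _); apply/matrixP=> i j; rewrite mxE summxE; apply: eq_bigr => k _.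
by rewrite !mxE mulrC mul_mpolyC.
Qed.

Let entry_eval x i j : (entry i j).@[x] = combination x i j.
Proof.
rewrite /entry /combination summxE rmorph_sum; apply: eq_bigr => k _.
by rewrite /= mevalZ mevalXU !mxE mulrC.
Qed.

Lemma det_poly_eval (x : 'I_r -> F) : (det_poly K).@[x] = \det (combination x).
Proof.
rewrite det_polyE -det_map_mx; congr (\det _).
by apply/matrixP=> i j; rewrite !mxE /= entry_eval.
Qed.

Lemma det_poly_deriv (x : 'I_r -> F) k :
  (mderiv k (det_poly K)).@[x] = det_deriv (combination x) (tnth K k).
Proof.
rewrite det_polyE /determinant /det_deriv (raddf_sum (mderiv k)) (raddf_sum (meval x)) /=.
apply: eq_bigr => t _.
rewrite mulr_sign -scaler_sign mderivZ mevalZ; congr (_ * _).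
rewrite (eq_bigr (fun i => entry i (t i))) => [|i _]; last by rewrite mxE.
rewrite mderiv_prod (raddf_sum (meval x)); apply: eq_bigr => i _ /=.
rewrite mevalM rmorph_prod; congr (_ * _); last first.
  by apply: eq_bigr => j _; rewrite /= entry_eval.
rewrite /entry (raddf_sum (mderiv k)) /= (bigD1 k) //= big1 => [|l lk].
  by rewrite addr0 mderivZ mderivXU eqxx mevalZ mevalC mulr1.
by rewrite mderivZ mderivXU (negPf lk) mpolyC0 scaler0.
Qed.

End DetDerivative.

Section BasisChange.
Variables (F : fieldType) (m : nat) (M : {vspace 'M[F]_m}) (S : 'M[F]_m).

(** Both sides of the critical equations are linear in the direction, so they extend from the basis
    to [M]; being critical thus depends only on the matrix [A]. *)
Lemma critical_pointE r (K : r.-tuple 'M[F]_m) (x : {ffun 'I_r -> F}) :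
  basis_of M K -> critical_point K S x <->
  let A := combination K x in
  \det A != 0 /\ forall B, B \in M -> det_deriv A B = \det A * \tr (S *m B).
Proof.
move=> Kbasis; rewrite /critical_point det_poly_eval /=; set A := combination K x.
split=> -[A0 critA]; split=> //; last first.
  move=> i; rewrite det_poly_deriv critA ?(basis_mem Kbasis) ?mem_tnth //.
  by rewrite mulrC mulKf.
move=> B BM; rewrite (coord_basis Kbasis BM) mulmx_sumr !linear_sum mulr_sumr.
apply: eq_bigr => i _; rewrite /= -scalemxAr !linearZ /= mulrCA; congr (_ * _).
by rewrite -tnth_nth -critA det_poly_deriv mulrC divfK.
Qed.

Lemma card_critical_point_basis r r' (K : r.-tuple 'M[F]_m) (L : r'.-tuple 'M[F]_m) d :
  basis_of M K -> basis_of M L ->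
  has_card (critical_point K S) d -> has_card (critical_point L S) d.
Proof.
move=> Kbasis Lbasis.
pose coords q (X : q.-tuple 'M[F]_m) (A : 'M[F]_m) := [ffun i => coord X i A].
have mem q (X : q.-tuple 'M[F]_m) x : basis_of M X -> combination X x \in M.
  move=> Xbasis; apply: memv_suml => i _; apply: memvZ.
  by rewrite (basis_mem Xbasis) // mem_tnth.
have coordsK q (X : q.-tuple 'M[F]_m) A : basis_of M X -> A \in M ->
    combination X (coords q X A) = A.
  move=> Xbasis AM; rewrite [RHS](coord_basis Xbasis AM); apply: eq_bigr => i _.
  by rewrite ffunE (tnth_nth 0).
have combinationK q (X : q.-tuple 'M[F]_m) (x : {ffun 'I_q -> F}) : basis_of M X ->
    coords q X (combination X x) = x.
  move=> Xbasis; apply/ffunP=> i; rewrite ffunE /combination.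
  under eq_bigr do rewrite (tnth_nth 0).
  by rewrite coord_sum_free // (basis_free Xbasis).
apply: (@has_card_bij _ _ _ _ (fun x : {ffun 'I_r -> F} => coords _ L (combination K x))
  (fun y : {ffun 'I_r' -> F} => coords _ K (combination L y))).
  move=> x /(critical_pointE _ Kbasis) crit; rewrite coordsK ?mem // combinationK //.
  by split=> //; apply/(critical_pointE _ Lbasis); rewrite coordsK ?mem.
move=> x /(critical_pointE _ Lbasis) crit; rewrite coordsK ?mem // combinationK //.
by split=> //; apply/(critical_pointE _ Kbasis); rewrite coordsK ?mem.
Qed.

End BasisChange.

(** Row 0 is a multiple of the first unit row plus [y0] times the all-ones row. Linearity in it
    leaves [B], which reduces to size [m], and [C], in which clearing with row 0 leaves
    [diag_mx y']. *)
Lemma det_diag_add_const (R : comNzRingType) m (y0 : R) (y : 'rV[R]_m) :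
  \det (diag_mx y + const_mx y0) =
  \prod_i y 0 i + y0 * \sum_i \prod_(j | j != i) y 0 j.
Proof.
elim: m y => [|m IHm] y; first by rewrite det_mx00 !big_ord0 mulr0 addr0.
pose y' : 'rV[R]_m := \row_i y 0 (lift ord0 i).
pose A' := diag_mx y' + const_mx y0.
pose B : 'M[R]_(1 + m) := block_mx 1%:M 0 (const_mx y0) A'.
pose C : 'M[R]_(1 + m) := block_mx 1%:M (const_mx 1) (const_mx y0) A'.
have detB : \det B = \det A' by rewrite det_lblock det1 mul1r.
have detC : \det C = \prod_i y' 0 i.
  have -> : C = block_mx 1%:M 0 (const_mx y0) 1%:M *m
                block_mx 1%:M (const_mx 1) 0 (diag_mx y').
    rewrite mulmx_block !mul1mx !mul0mx mulmx1 !addr0 /C /A' addrC.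
    congr block_mx; congr (_ + _); apply/matrixP=> i j.
    by rewrite !mxE big_ord1 !mxE mulr1.
  by rewrite det_mulmx det_lblock det_ublock !det1 !mul1r det_diag.
pose A : 'M[R]_(1 + m) := diag_mx y + const_mx y0.
have -> : \det (diag_mx y + const_mx y0) = y 0 ord0 * \det B + y0 * \det C.
  apply: (@determinant_multilinear _ _ A B C ord0).
  - apply/rowP=> j; case: (unliftP ord0 j) => [i|] ->;
    do 3?rewrite !(mxE, split1) ?liftK ?unlift_none /=; ring.
  - apply/matrixP=> i j; case: (unliftP ord0 j) => [l|] ->;
    do 3?rewrite !(mxE, split1) ?liftK ?unlift_none /=; rewrite ?add0r //.
  - apply/matrixP=> i j; case: (unliftP ord0 j) => [l|] ->;
    do 3?rewrite !(mxE, split1) ?liftK ?unlift_none /=; rewrite ?add0r //.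
rewrite detB detC IHm big_ord_recl.
have -> : \sum_i \prod_(j | j != i) y 0 j =
    \prod_i y' 0 i + y 0 ord0 * \sum_i \prod_(j | j != i) y' 0 j.
  rewrite big_ord_recl; congr (_ + _).
    rewrite big_mkcond big_ord_recl /= mul1r; apply: eq_bigr => i _.
    by rewrite mxE.
  rewrite mulr_sumr; apply: eq_bigr => i _; rewrite big_mkcond big_ord_recl /=.
  congr (_ * _); rewrite -big_mkcond /=; apply: eq_big => [j|j _].
    by rewrite (inj_eq lift_inj).
  by rewrite mxE.
have -> : \prod_i y 0 (lift ord0 i) = \prod_i y' 0 i by apply: eq_bigr => i _; rewrite mxE.
ring.
Qed.

Lemma tree_sum_recl (R : comNzRingType) m (Y : 'I_m.+1 -> R) :
  tree_sum Y = \prod_i Y (lift ord0 i) +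
    Y ord0 * \sum_i \prod_(j | j != i) Y (lift ord0 j).
Proof.
rewrite /tree_sum big_ord_recl; congr (_ + _).
  by rewrite big_mkcond big_ord_recl /= mul1r.
rewrite mulr_sumr; apply: eq_bigr => i _; rewrite big_mkcond big_ord_recl /=.
by congr (_ * _); rewrite -big_mkcond /=; apply: eq_bigl => j; rewrite (inj_eq lift_inj).
Qed.

Lemma mderiv_tree_sum (F : fieldType) m (k : 'I_m.+1) (x : 'I_m.+1 -> F) :
  (mderiv k (tree_sum (fun j => 'X_j : {mpoly F[m.+1]}))).@[x] = tree_sum_deriv k x.
Proof.
have mderiv0 (P : pred 'I_m.+1) : ~~ P k ->
    mderiv k (\prod_(j | P j) ('X_j : {mpoly F[m.+1]})) = 0.
  move=> Pk; apply: (big_ind (fun p => mderiv k p = 0)) => [|p q p0 q0|j Pj].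
  - exact: mderivC.
  - by rewrite mderivM p0 q0 mul0r mulr0 addr0.
  rewrite mderivXU; case: eqP => [jk|]; last by rewrite mpolyC0.
  by rewrite jk (negPf Pk) in Pj.
rewrite /tree_sum (raddf_sum (mderiv k)) (raddf_sum (meval x)) /= (bigD1 k) //=.
rewrite mderiv0 ?eqxx // meval0 add0r; apply: eq_bigr => i ik.
rewrite (bigD1 k) 1?eq_sym //= mderivM mderivXU eqxx mul1r mderiv0; last first.
  by rewrite eqxx andbF.
rewrite mulr0 addr0 rmorph_prod; apply: eq_big => [j|j _]; first by rewrite andbC.
by rewrite /= mevalXU.
Qed.

(** * The model spanned by the diagonal units and the all-ones matrix, up to congruence *)

Section StarModel.
Variables (F : fieldType) (m : nat) (B : 'M[F]_m).
Hypothesis B_unit : B \in unitmx.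

Definition star_mx (R : nzRingType) (j : 'I_m.+1) : 'M[R]_m :=
  if unlift ord0 j is Some i then delta_mx i i else const_mx 1.

Definition star_basis : m.+1.-tuple 'M[F]_m :=
  [tuple B *m star_mx F j *m B^T | j < m.+1].

Lemma sum_star_mx (R : nzRingType) (Y : 'I_m.+1 -> R) :
  \sum_j Y j *: star_mx R j =
  diag_mx (\row_i Y (lift ord0 i)) + const_mx (Y ord0).
Proof.
rewrite big_ord_recl addrC /star_mx unlift_none; congr (_ + _).
  rewrite diag_mx_sum_delta; apply: eq_bigr => i _.
  by rewrite liftK mxE.
by apply/matrixP=> i j; rewrite !mxE mulr1.
Qed.

Lemma star_combination (Y : 'I_m.+1 -> F) :
  combination star_basis Y =
  B *m (diag_mx (\row_i Y (lift ord0 i)) + const_mx (Y ord0)) *m B^T.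
Proof.
rewrite -sum_star_mx mulmx_sumr mulmx_suml; apply: eq_bigr => j _.
by rewrite tnth_mktuple -scalemxAr -scalemxAl.
Qed.

Lemma det_poly_star :
  det_poly star_basis = (\det B ^+ 2)%:MP * tree_sum (fun j => 'X_j).
Proof.
pose B' := map_mx (@mpolyC m.+1 F) B.
rewrite /det_poly [X in \det X](_ : _ = B' *m
    (\sum_j 'X_j *: star_mx {mpoly F[m.+1]} j) *m B'^T); last first.
  rewrite mulmx_sumr mulmx_suml; apply: eq_bigr => j _.
  rewrite tnth_mktuple -scalemxAr -scalemxAl !map_mxM map_trmx; congr (_ *: (_ *m _ *m _)).
  by rewrite /star_mx; case: unlift => [i|]; rewrite ?map_delta_mx ?map_const_mx ?rmorph1.
rewrite !det_mulmx det_tr sum_star_mx det_diag_add_const det_map_mx rmorphXn tree_sum_recl.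
under eq_bigr do rewrite mxE.
under [X in _ + _ * X]eq_bigr do under eq_bigr do rewrite mxE.
by rewrite /=; ring.
Qed.

(** The congruence scales the determinant by [\det B ^+ 2], which cancels in the logarithmic
    derivative. *)
Lemma critical_point_star (S : 'M[F]_m) (x : {ffun 'I_m.+1 -> F}) :
  critical_point star_basis S x <->
  tree_sum x != 0 /\
  forall i, tree_sum_deriv i x = \tr (S *m tnth star_basis i) * tree_sum x.
Proof.
have c0 : \det B ^+ 2 != 0 by rewrite expf_neq0 // -unitfE -unitmxE.
have evalE : (det_poly star_basis).@[x] = \det B ^+ 2 * tree_sum x.
  rewrite det_poly_star mevalM mevalC; congr (_ * _).
  rewrite /tree_sum rmorph_sum; apply: eq_bigr => i _.
  by rewrite /= rmorph_prod; apply: eq_bigr => j _; rewrite /= mevalXU.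
have derivE i : (mderiv i (det_poly star_basis)).@[x] =
    \det B ^+ 2 * tree_sum_deriv i x.
  by rewrite det_poly_star mderiv_mulC mevalM mevalC mderiv_tree_sum.
rewrite /critical_point evalE mulf_eq0 negb_or c0 /=.
split=> -[E0 crit]; split=> // i.
  by rewrite -crit derivE -mulf_div divff // mul1r divfK.
by rewrite derivE crit -mulf_div divff // mul1r mulfK.
Qed.

Lemma star_basis_free : (2 <= m)%N -> free star_basis.
Proof.
move=> m2; apply/freeP => Y.
under eq_bigr do rewrite -tnth_nth.
rewrite -/(combination _ _) star_combination => /(congr1 (fun A => invmx B *m A *m invmx B^T)).
rewrite -!mulmxA mulmxV ?unitmx_tr // mulmx1 mulmxA mulVmx // mul1mx mul0mx mulmx0.
move=> /matrixP E.
(* Off the diagonal only the all-ones matrix contributes; [2 <= m] provides such an entry. *)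
have Y0 : Y ord0 = 0.
  have := E (Ordinal (ltnW m2)) (Ordinal m2).
  by rewrite !mxE add0r.
move=> j; case: (unliftP ord0 j) => [i|] -> //.
by have := E i i; rewrite !mxE eqxx Y0 addr0.
Qed.

End StarModel.

Lemma mxtrace_delta_mul (R : comNzRingType) m (i j : 'I_m) (A : 'M[R]_m) :
  \tr (delta_mx i j *m A) = A j i.
Proof.
rewrite /mxtrace (bigD1 i) //= big1 => [|l li]; rewrite !mxE.
  rewrite (bigD1 j) //= big1 => [|k kj]; rewrite !mxE ?eqxx ?mul1r ?addr0 //.
  by rewrite (negPf kj) andbF mul0r.
by apply: big1 => k _; rewrite !mxE (negPf li) mul0r.
Qed.

(** Provides the witnesses for genericity: a symmetric [S] realizes each unit vector of trace
    values. *)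
Lemma star_basis_dual (F : numFieldType) m (B : 'M[F]_m) (j : 'I_m.+1) :
  (2 <= m)%N -> B \in unitmx ->
  exists2 S : 'M[F]_m, S^T = S &
    forall i, \tr (S *m tnth (star_basis B) i) = (i == j)%:R.
Proof.
move=> m2 Bu; pose p := Ordinal (ltnW m2); pose q := Ordinal m2.
(* [S0] reads off a symmetrized off-diagonal entry: it pairs to 1 with the all-ones matrix and to 0
   with each diagonal unit. Subtracting it below removes the pairing of a diagonal unit with the
   all-ones matrix. *)
pose S0 : 'M[F]_m := 2^-1 *: (delta_mx p q + delta_mx q p).
pose S' := if unlift ord0 j is Some i then delta_mx i i - S0 else S0.
have S0sym : S0^T = S0 by rewrite linearZ linearD /= !trmx_delta addrC.
exists ((invmx B)^T *m S' *m invmx B).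
  rewrite !trmx_mul trmxK mulmxA; congr (_ *m _ *m _).
  by rewrite /S'; case: unlift => [i|] //; rewrite linearB /= trmx_delta S0sym.
move=> i; rewrite tnth_mktuple !mulmxA mulmxKV // mxtrace_mulC !mulmxA.
rewrite trmx_inv mulmxV ?unitmx_tr // mul1mx.
have trS0 A : \tr (S0 *m A) = 2^-1 * (A q p + A p q).
  by rewrite -scalemxAl linearZ mulmxDl linearD /= !mxtrace_delta_mul.
have n2 : 2 != 0 :> F by rewrite pnatr_eq0.
have trS0E l : \tr (S0 *m star_mx F l) = (l == ord0)%:R.
  rewrite trS0 /star_mx; case: (unliftP ord0 l) => [k|] ->; rewrite ?liftK ?unlift_none !mxE.
    have pq : (p == q) = false by [].
    by case: eqP => [<-|_]; rewrite ?pq ?andbF /= ?addr0 ?mulr0.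
  by rewrite eqxx mulVf.
rewrite /S'; case: (unliftP ord0 j) => [k|] ->; last exact: trS0E.
rewrite mulmxBl linearB /= trS0E mxtrace_delta_mul /star_mx.
case: (unliftP ord0 i) => [l|] ->; rewrite ?liftK ?unlift_none !mxE.
  by rewrite subr0 (inj_eq lift_inj) andbb eq_sym.
by rewrite eqxx subrr.
Qed.

(** * Genericity *)

Definition sym_nonvanishing (F : fieldType) m (P : {mpoly F[m * m]}) : Prop :=
  exists S : 'M[F]_m, S^T = S /\ P.@[mxvec S 0] != 0.

(** Nonempty open sets of symmetric matrices meet, so each genericity condition may be checked at
    its own witness. *)
Lemma sym_nonvanishingM (F : numFieldType) m (P Q : {mpoly F[m * m]}) :
  sym_nonvanishing P -> sym_nonvanishing Q -> sym_nonvanishing (P * Q).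
Proof.
move=> nzP nzQ.
have gen (P' : {mpoly F[m * m]}) : sym_nonvanishing P' ->
    for_generic_sym (fun S : 'M[F]_m => S^T = S /\ P'.@[mxvec S 0] != 0).
  by move=> nz; exists P'; split.
have [S [[symS PS] [_ QS]]] := for_generic_sym_meet (gen _ nzP) (gen _ nzQ).
by exists S; split=> //; rewrite mevalM mulf_neq0.
Qed.

Lemma sym_nonvanishing_prod (F : numFieldType) m (I : finType) (P : I -> {mpoly F[m * m]}) :
  (forall i, sym_nonvanishing (P i)) -> sym_nonvanishing (\prod_i P i).
Proof.
move=> nzP; apply: (big_ind (@sym_nonvanishing F m)) => [||i _]; last exact: nzP.
  by exists 0; rewrite trmx0 meval1 oner_neq0.
exact: sym_nonvanishingM.
Qed.

Section StarDegree.
Variables (F : numClosedFieldType) (m : nat) (B : 'M[F]_m).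
Hypotheses (m2 : (2 <= m)%N) (B_unit : B \in unitmx).

Let trace_form (j : 'I_m.+1) : {mpoly F[m * m]} :=
  \sum_a \sum_b tnth (star_basis B) j b a *: 'X_(mxvec_index a b).

Let trace_formE j (S : 'M[F]_m) :
  (trace_form j).@[mxvec S 0] = \tr (S *m tnth (star_basis B) j).
Proof.
rewrite /trace_form /mxtrace (raddf_sum (meval _)); apply: eq_bigr => a _ /=.
rewrite (raddf_sum (meval _)) mxE; apply: eq_bigr => b _ /=.
by rewrite mevalZ mevalXU mxvecE mulrC.
Qed.

Let sum_trace_form j (S : 'M[F]_m) :
  (\sum_(i | i != j) trace_form i).@[mxvec S 0] =
  \sum_(i | i != j) (trace_form i).@[mxvec S 0].
Proof. exact: raddf_sum. Qed.

Let p := elim_poly (trace_form ord0) (fun i => trace_form (lift ord0 i)).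
Let q := ram_poly (trace_form ord0) (fun i => trace_form (lift ord0 i)).

(** Specialized at trace values [(1, 0, ..., 0)], [p] already attains the maximal degree [2 ^ m], so
    its leading coefficient survives there, and [q] becomes a nonzero constant. *)
Let elim_witness : size p = (2 ^ m).+1 /\ exists S : 'M[F]_m, S^T = S /\
  ((meval (mxvec S 0) (lead_coef p) != 0) /\
   coprimep (map_poly (meval (mxvec S 0)) p) (map_poly (meval (mxvec S 0)) q)).
Proof.
have [S symS trS] := star_basis_dual ord0 m2 B_unit.
pose f : {rmorphism {mpoly F[m * m]} -> F} := meval (mxvec S 0).
have fb : f (trace_form ord0) = 1 by rewrite /f /= trace_formE trS eqxx.
have fa i : (f \o (fun i => trace_form (lift ord0 i))) i = 0 by rewrite /f /= trace_formE trS.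
have size_fp : size (map_poly f p) = (2 ^ m).+1.
  by rewrite map_elim_poly fb size_elim_poly_witness.
have size_p : size p = (2 ^ m).+1.
  by apply/eqP; rewrite eqn_leq size_elim_poly_leq -size_fp; exact: size_poly.
split=> //; exists S; split=> //; split; last first.
  rewrite map_ram_poly fb coprimep_sym.
  have /eqP := size_ram_poly_witness fa; rewrite size_poly_eq1.
  by move/eqp_coprimepl->; rewrite coprime1p.
rewrite lead_coefE size_p -coef_map -size_fp -lead_coefE lead_coef_eq0.
by rewrite -size_poly_gt0 size_fp.
Qed.

Theorem ml_degree_star (M : {vspace 'M[F]_m}) :
  basis_of M (star_basis B) -> has_ml_degree M (2 ^ m - m.+1).
Proof.
move=> basisM r K basisK.
have [size_p _] := elim_witness.
have [P PE] := coprimep_locus F p q.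
(* [P] guards degree and coprimality; the other factors keep each [s_j] nonzero and different from
   the sum of the others. *)
pose Q := P * \prod_j (trace_form j * (trace_form j - \sum_(i | i != j) trace_form i)).
exists Q; split.
  apply: sym_nonvanishingM.
    by have [_ [S [symS /andP nz]]] := elim_witness; exists S; rewrite PE.
  apply: sym_nonvanishing_prod => j.
  have [S symS trS] := star_basis_dual j m2 B_unit.
  exists S; split=> //; rewrite mevalM mevalB sum_trace_form.
  rewrite trace_formE trS eqxx big1 => [|i ij]; last by rewrite trace_formE trS (negPf ij).
  by rewrite subr0 mulr1 oner_neq0.
move=> S symS; rewrite /Q mevalM mulf_eq0 negb_or PE rmorph_prod => /andP[/andP[lead_p copr]].
move=> /prodf_neq0 nz.
pose s j := (trace_form j).@[mxvec S 0].
have {}nz j : (s j != 0) && (s j != \sum_(i | i != j) s i).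
  have := nz j isT.
  by rewrite /= mevalM mulf_eq0 negb_or mevalB subr_eq0 sum_trace_form.
apply: (card_critical_point_basis (K := star_basis B) basisM basisK).
have [L [uL sizeL LP]] : has_card (tree_critical s) (2 ^ m - m.+1).
  apply: card_tree_critical => [j|j|]; [by case/andP: (nz j)|by case/andP: (nz j)|].
  apply: card_quadric_system.
  - by case/andP: (nz ord0).
  - by rewrite -[LHS]/(size (elim_poly _ _)) -size_p -(size_map_poly_id0 lead_p) map_elim_poly.
  - by move: copr; rewrite map_elim_poly map_ram_poly.
exists L; split=> // x; split=> [/LP[E0 crit]|/(critical_point_star B_unit)[E0 crit]].
  by apply/(critical_point_star B_unit); split=> // i; rewrite crit -trace_formE.
by apply/LP; split=> // i; rewrite crit -trace_formE.
Qed.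

End StarDegree.

(** * The cycle graph *)

Section CycleLaplacian.
Variables (F : fieldType) (p : nat).
Local Notation V := 'I_p.+3.
Local Notation G := (cycle_graph p.+3).
Implicit Types (i j k a : V) (x : {ffun edge G -> F^o}).

Lemma ordS_add1 i : ordS i = i + 1.
Proof. by apply: val_inj; rewrite /= addn1. Qed.

Let add1_neq i : (i + 1 == i) = false.
Proof. by rewrite -subr_eq0 addrAC subrr add0r. Qed.

Let add2_neq i : (i + 1 + 1 == i) = false.
Proof. by rewrite -addrA -subr_eq0 addrAC subrr add0r. Qed.

Lemma cycle_edgeP a l :
  ([set a; l] \in edges G) = (l == a + 1) || (a == l + 1).
Proof.
apply/imsetP/orP => [[i _ /setP E]|].
  move: (E a) (E l) (E i) (E (i + 1)); rewrite !inE !ordS_add1 !eqxx ?orbT /=.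
  move=> /esym/orP[]/eqP-> /esym/orP[]/eqP->; rewrite ?eqxx ?orbT ?add1_neq; auto.
  by rewrite eq_sym add1_neq.
case=> /eqP->.
  by exists a; rewrite ?inE ordS_add1 ?add1_neq.
by exists l; rewrite ?inE ordS_add1 ?add1_neq // setUC.
Qed.

(** Otherwise [j + 1 + 1 = j], impossible in a cyclic group of order at least 3. *)
Lemma cycle_edge_inj i j : [set i; i + 1] = [set j; j + 1] -> i = j.
Proof.
move=> /setP E; move: (E i) (E (i + 1)); rewrite !inE !eqxx orbT /=.
move=> /esym/orP[/eqP//|/eqP->]; rewrite add1_neq orbF /=.
by rewrite add2_neq.
Qed.

Definition cycle_weight x i : F := edge_val x i (i + 1).

Lemma cycle_weight_onto (Y : V -> F) : exists x, forall i, cycle_weight x i = Y i.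
Proof.
exists [ffun e => \sum_(i | [set i; i + 1] == val e) Y i] => i.
have ei : [set i; i + 1] \in edges G by rewrite cycle_edgeP eqxx.
rewrite /cycle_weight /edge_val insubT /= ffunE /=.
rewrite (eq_bigl (pred1 i)) ?big_pred1_eq // => j /=.
by apply/eqP/eqP => [/cycle_edge_inj|->].
Qed.

(** The signed incidence vector of the edge oriented from [i] to [i + 1]. *)
Definition incidence i a : F := (a == i)%:R - (a == i + 1)%:R.

Lemma laplacian_incidence x a l :
  laplacian x a l = \sum_i cycle_weight x i * (incidence i a * incidence i l).
Proof.
have pick1 (g : V -> F) b : \sum_i g i * (b == i)%:R = g b.
  rewrite (bigD1 b) //= eqxx mulr1 big1 ?addr0 // => i ib.
  by rewrite eq_sym (negPf ib) mulr0.
have pick2 (g : V -> F) b : \sum_i g i * (b == i + 1)%:R = g (b - 1).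
  rewrite -(pick1 g (b - 1)); apply: eq_bigr => i _.
  by rewrite subr_eq.
have -> : \sum_i cycle_weight x i * (incidence i a * incidence i l) =
    (a == l)%:R * (cycle_weight x a + cycle_weight x (a - 1))
    - (l == a + 1)%:R * cycle_weight x a - (a == l + 1)%:R * cycle_weight x l.
  rewrite (eq_bigr (fun i =>
    cycle_weight x i * (l == i)%:R * (a == i)%:R +
    cycle_weight x i * (l == i + 1)%:R * (a == i + 1)%:R -
    cycle_weight x i * (l == i + 1)%:R * (a == i)%:R -
    cycle_weight x i * (a == i + 1)%:R * (l == i)%:R)) => [|i _]; last first.
    by rewrite /incidence; ring.
  rewrite !sumrB big_split /= !pick1 pick2 subrK eq_sym.
  by ring.
have ev u w : edge_val x u w = edge_val x w u by rewrite /edge_val setUC.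
have m1 : a - 1 + 1 = a by rewrite subrK.
rewrite mxE cycle_edgeP; have [<-|al] := eqVneq a l.
  rewrite eq_sym add1_neq !mul0r !subr0 mul1r.
  (* The neighbours [a + 1] and [a - 1] are distinct, so the diagonal sum has exactly two terms. *)
  rewrite (bigD1 (a + 1)) ?cycle_edgeP ?eqxx //= (bigD1 (a - 1)) /=; last first.
    rewrite cycle_edgeP subrK eqxx orbT /=; apply: contraFN (add2_neq a) => /eqP <-.
    by rewrite subrK.
  rewrite big1 => [|i]; last first.
    rewrite cycle_edgeP -andbA => /and3P[/orP[->//|/eqP->]] _.
    by rewrite addrK eqxx.
  by rewrite addr0 (ev a (a - 1)) /cycle_weight m1.
rewrite mul0r sub0r; have [->|la] := eqVneq l (a + 1).
  by rewrite eq_sym add2_neq mul1r mul0r subr0.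
rewrite mul0r oppr0 sub0r /=; case: eqP => [->|_]; last by rewrite mul0r oppr0.
by rewrite mul1r /cycle_weight ev.
Qed.

(** Rows are the vertices other than [k]; columns are the edges other than the one from [k] to
    [k + 1], which form a spanning path. *)
Definition incidence_mx k : 'M[F]_p.+2 :=
  \matrix_(q, j) incidence (k + lift ord0 j) (lift k q).

Lemma sum_incidence a : \sum_i incidence i a = 0.
Proof.
by rewrite sumrB [X in X - _](reindex_inj (addIr (1 : V))) subrr.
Qed.

(** A kernel vector is a potential that is zero at [k] and constant along each edge of the path,
    hence zero. *)
Lemma incidence_mx_unit k : incidence_mx k \in unitmx.
Proof.
rewrite -row_free_unit; apply: inj_row_free => v vB.
pose rho a : F := if unlift k a is Some q then v 0 q else 0.
have rho_k : rho k = 0 by rewrite /rho unlift_none.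
have rho_lift q : rho (lift k q) = v 0 q by rewrite /rho liftK.
have rho_step i : i != k -> rho i = rho (i + 1).
  move=> ik; apply/eqP; rewrite -subr_eq0; apply/eqP.
  have ik0 : i - k != 0 by rewrite subr_eq0.
  have [j ijk] : exists j : 'I_p.+2, i = k + lift ord0 j.
    case: (unliftP ord0 (i - k)) ik0 => [j ij _|->]; last by rewrite eqxx.
    by exists j; rewrite -ij addrC subrK.
  have /rowP/(_ j) := vB; rewrite !mxE => <-.
  have -> : rho i - rho (i + 1) = \sum_a rho a * incidence i a.
    rewrite /incidence; under eq_bigr do rewrite mulrBr.
    rewrite sumrB (bigD1 i) //= eqxx mulr1 big1 ?addr0 => [|a /negPf->]; last by rewrite mulr0.
    rewrite (bigD1 (i + 1)) //= eqxx mulr1 big1 ?addr0 // => a /negPf->; exact: mulr0.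
  rewrite (bigD1_ord k) //= rho_k mul0r add0r; apply: eq_bigr => q _.
  by rewrite mxE rho_lift -ijk.
(* Walk backwards from [k]; the omitted edge is reached only on returning to [k], where the value is
   0 anyway. *)
have rho0 (t : nat) : rho (k - t%:R) = 0.
  elim: t => [|t IHt]; first by rewrite subr0.
  have [->//|ne] := eqVneq (k - t.+1%:R) k.
  by rewrite rho_step // -natr1 opprD addrA subrK.
apply/rowP=> q; rewrite mxE -rho_lift -(rho0 (k - lift k q)).
by rewrite natr_Zp opprB addrC subrK.
Qed.

(** The incidence vectors sum to zero around the cycle, so the omitted one is minus the sum of the
    columns of [B]. Its rank-one matrix is [B *m J *m B^T] with [J] all ones; the other edges give
    the diagonal units. *)
Lemma reduced_laplacian_star k x :
  reduced_laplacian k x =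
  combination (star_basis (incidence_mx k)) (fun j => cycle_weight x (k + j)).
Proof.
set B := incidence_mx k.
have sumB q : \sum_i B q i = - incidence k (lift k q).
  apply/eqP; rewrite -addr_eq0; apply/eqP.
  rewrite -[RHS](sum_incidence (lift k q)) [RHS](reindex_inj (addrI k)) /=.
  rewrite [RHS](bigD1_ord ord0) //= addr0 [RHS]addrC; congr (_ + _).
  by apply: eq_bigr => i _; rewrite mxE.
have starE j q r : (B *m star_mx F j *m B^T) q r =
    incidence (k + j) (lift k q) * incidence (k + j) (lift k r).
  rewrite /star_mx; case: (unliftP ord0 j) => [i|] ->.
    have -> : delta_mx i i = delta_mx i (0 : 'I_1) *m delta_mx 0 i :> 'M[F]_p.+2.
      by rewrite mul_delta_mx.
    rewrite mulmxA -colE -mulmxA -rowE !mxE big_ord1 !mxE //.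
  have -> : const_mx 1 = const_mx 1 *m (const_mx 1 : 'rV_p.+2) :> 'M[F]_p.+2.
    by apply/matrixP=> u w; rewrite !mxE big_ord1 !mxE mulr1.
  rewrite mulmxA -mulmxA !mxE big_ord1 !mxE addr0 -[RHS]mulrNN -!sumB.
  by congr (_ * _); apply: eq_bigr => i _; rewrite !mxE ?mulr1 ?mul1r.
apply/matrixP=> q r; rewrite 2!mxE laplacian_incidence (reindex_inj (addrI k)) summxE.
by apply: eq_bigr => j _; rewrite /= mxE tnth_mktuple starE.
Qed.

Lemma star_basis_spanning_tree_model k :
  basis_of (spanning_tree_model F G k) (star_basis (incidence_mx k)).
Proof.
have fr : free (star_basis (incidence_mx k)).
  by apply: star_basis_free => //; apply: incidence_mx_unit.
rewrite /basis_of fr andbT eqEsubv; apply/andP; split; last first.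
  apply/subvP=> A /mem_spanning_tree_model[x ->].
  rewrite reduced_laplacian_star; apply: memv_suml => j _; apply: memvZ.
  by rewrite memv_span // mem_tnth.
apply/span_subvP => A /tnthP[j ->]; apply/mem_spanning_tree_model.
have [x xE] := cycle_weight_onto (fun i => (i == k + j)%:R).
exists x; rewrite reduced_laplacian_star /combination (bigD1 j) //= xE eqxx scale1r.
rewrite big1 ?addr0 // => i ij; rewrite xE (inj_eq (addrI k)) (negPf ij) scale0r //.
Qed.

End CycleLaplacian.

(** * The subset count and the conclusion *)

Lemma card_subsets_ge2 m :
  #|[set A : {set 'I_m} | (2 <= #|A|)%N]| = (2 ^ m - m.+1)%N.
Proof.
pose S := [set A : {set 'I_m} | (2 <= #|A|)%N].
have <- : (#|~: S| + #|S| = 2 ^ m)%N.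
  by rewrite addnC cardsC -cardsT -powersetT card_powerset cardsT card_ord.
(* The excluded subsets are the empty set and the [m] singletons. *)
have -> : ~: S = set0 |: [set [set i] | i : 'I_m].
  apply/setP=> A; rewrite !inE -ltnNge ltnS leq_eqVlt ltnS leqn0 cards_eq0 orbC.
  congr (_ || _); apply/cards1P/imsetP => [[i ->]|[i _ ->]]; by exists i.
rewrite cardsU1 card_imset ?card_ord; last exact: set1_inj.
rewrite (_ : set0 \notin _) ?addKn //.
by apply/imsetP => -[i _ /setP/(_ i)]; rewrite !inE eqxx.
Qed.

Local Open Scope complex_scope.

Theorem theorem2p13 (R : realType) (n : nat) (hn : (3 <= n)%N) (k : 'I_n) :
  has_ml_degree (spanning_tree_model R[i] (cycle_graph n) k)
    #|[set A : {set 'I_n.-1} | (2 <= #|A|)%N]| /\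
  #|[set A : {set 'I_n.-1} | (2 <= #|A|)%N]| = (2 ^ n.-1 - n)%N.
Proof.
case: n hn k => [|[|[|p]]] // _ k; rewrite /= card_subsets_ge2; split=> //.
exact: (ml_degree_star _ (incidence_mx_unit _ k) (star_basis_spanning_tree_model _ k)).
Qed.
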